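(* There exists a constant $C_d$ depending only on $d$ such that the following holds. Let $K$ be a compact domain of $\mathbb{R}^d$ with rectifiable boundary and let $u,v:K\to\mathbb{R}$ be two $L$-Lipschitz functions on $K$ that are convex on any segment included in $K$. Then $$\|\nabla u-\nabla v\|_{L^2(K,\mathbb{R}^d)}^2\leq C_d\,\mathcal{H}^{d-1}(\partial K)^{2/3}\,L^{4/3}\,\|u-v\|_{L^2(K)}^{2/3}.$$
   Context: $\mathcal{H}^{d-1}$ is the $(d-1)$-dimensional Hausdorff measure, and ''rectifiable boundary'' means that $\partial K$ is $\mathcal{H}^{d-1}$-rectifiable. $L^2$ norms on $K$ are with respect to Lebesgue measure; gradients are defined almost everywhere. *)

(* Defs.v *)
From HB Require Import structures.
From mathcomp Require Import all_boot all_order all_algebra.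
From mathcomp Require Import all_classical all_reals all_analysis.
Import Order.TTheory GRing.Theory Num.Theory.
Import numFieldNormedType.Exports.

Set Implicit Arguments.
Unset Strict Implicit.
Unset Printing Implicit Defensive.

Local Open Scope classical_set_scope.
Local Open Scope ring_scope.

(* The library norm on 'rV[R]_n is the sup norm; metric notions below use the
   Euclidean norm instead. *)
Definition enorm (R : realType) (n : nat) (x : 'rV[R]_n) : R :=
  Num.sqrt (\sum_(i < n) x 0 i ^+ 2).

Definition measure_rV_display : measure_display -> measure_display.
Proof. exact. Qed.

(* The product sigma-algebra; for R : realType it is the Borel one. *)
Section measurable_rV.
Context {d} {T : sigmaRingType d} (n : nat).

Let coors : 'I_n -> 'rV[T]_n -> T := fun i x => x 0 i.

Let rV_set0 : g_sigma_preimage coors set0.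
Proof. exact: sigma_algebra0. Qed.

Let rV_setC A : g_sigma_preimage coors A -> g_sigma_preimage coors (~` A).
Proof. exact: sigma_algebraC. Qed.

Let rV_bigcup (F : _^nat) : (forall i, g_sigma_preimage coors (F i)) ->
  g_sigma_preimage coors (\bigcup_i (F i)).
Proof. exact: sigma_algebra_bigcup. Qed.

HB.instance Definition _ := @isMeasurable.Build (measure_rV_display d)
  'rV[T]_n (g_sigma_preimage coors) rV_set0 rV_setC rV_bigcup.

End measurable_rV.

Lemma measurable_coor d (T : sigmaRingType d) n (i : 'I_n) :
  measurable_fun [set: 'rV[T]_n] (fun x : 'rV[T]_n => x 0 i).
Proof.
move=> _ Y mY; rewrite setTI; apply: sub_sigma_algebra => /=.
rewrite -bigcup_seq/=; exists i => /=; first by rewrite mem_index_enum.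
by exists Y => //; rewrite setTI.
Qed.

Lemma measurable_fun_rV d1 d2 (T1 : measurableType d1) (T2 : sigmaRingType d2)
    n (f : T1 -> 'rV[T2]_n) :
  (forall i, measurable_fun [set: T1] (fun x => f x 0 i)) ->
  measurable_fun [set: T1] f.
Proof.
move=> mf _ A mA; rewrite setTI.
pose G : set (set 'rV[T2]_n) := image_set_system setT f measurable.
suff : G A by rewrite /G /image_set_system /= setTI.
move: A mA; apply: smallest_sub.
  exact/sigma_algebra_image/sigma_algebra_measurable.
rewrite -bigcup_seq => B [i _ [C mC <-]]; rewrite /G /image_set_system /=.
by rewrite !setTI -[X in measurable X]setTI; exact: (mf i).
Qed.

Definition row_cons (R : Type) (n : nat) (p : R * 'rV[R]_n) : 'rV[R]_n.+1 :=
  \row_i (if unlift ord0 i is Some j then p.2 0 j else p.1).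

Section lebesgue_rV.
Context {R : realType}.

Lemma measurable_row_cons n :
  measurable_fun [set: measurableTypeR R * 'rV[R]_n] (@row_cons R n).
Proof.
apply: measurable_fun_rV => i.
rewrite (_ : (fun _ => _) = fun p : measurableTypeR R * 'rV[R]_n =>
    if unlift ord0 i is Some j then p.2 0 j else p.1); last first.
  by apply/funext => p; rewrite mxE.
case: (unlift ord0 i) => [j|]; last exact: measurable_fst.
apply: (measurableT_comp (measurable_coor j)); exact: measurable_snd.
Qed.

(* Lebesgue measure on R^n, as the n-fold product of the one on R. *)
Fixpoint lebesgue_rV (n : nat) : set 'rV[R]_n -> \bar R :=
  if n is n'.+1 then
    pushforward (product_measure2 (@lebesgue_measure R) (@lebesgue_rV n'))
      (@row_cons R n')
  else \d_(0 : 'rV[R]_0).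

Lemma lebesgue_rV_measure n :
  {m : {measure set 'rV[R]_n -> \bar R} | m = @lebesgue_rV n :> (set _ -> _)}.
Proof.
elim: n => [|n [m mE]]; first by exists (\d_(0 : 'rV[R]_0)).
have mcons := @measurable_row_cons n.
exists (@measure_function_pushforward__canonical__measure_function_Measure
  _ _ _ _ _ (product_measure2 lebesgue_measure m) _ mcons).
by rewrite /= -mE.
Qed.

Section instance.
Variable n : nat.

Let lebesgue0 : @lebesgue_rV n set0 = 0%E.
Proof. by case: (lebesgue_rV_measure n) => m <-; exact: measure0. Qed.

Let lebesgue_ge0 A : (0 <= @lebesgue_rV n A)%E.
Proof. by case: (lebesgue_rV_measure n) => m <-; exact: measure_ge0. Qed.

Let lebesgue_sigma_additive : semi_sigma_additive (@lebesgue_rV n).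
Proof.
by case: (lebesgue_rV_measure n) => m <-; exact: measure_semi_sigma_additive.
Qed.

HB.instance Definition _ := isMeasure.Build _ _ _ (@lebesgue_rV n)
  lebesgue0 lebesgue_ge0 lebesgue_sigma_additive.

End instance.

Lemma measurable_rV_box n (A : 'I_n -> set R) :
  (forall i, measurable (A i)) ->
  measurable [set x : 'rV[R]_n | forall i, A i (x 0 i)].
Proof.
move=> mA; rewrite (_ : [set _ | _] =
    \big[setI/setT]_(i < n) ((fun x : 'rV[R]_n => x 0 i) @^-1` A i)).
  apply: bigsetI_measurable => i _.
  rewrite -[X in measurable X]setTI; exact: measurable_coor.
rewrite -bigcap_seq; apply/seteqP; split => x /= Ax i; first by move=> _; exact: Ax.
by apply: (Ax i); rewrite /= mem_index_enum.
Qed.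

Lemma lebesgue_rV_box n (A : 'I_n -> set R) : (forall i, measurable (A i)) ->
  lebesgue_rV [set x : 'rV[R]_n | forall i, A i (x 0 i)] =
  (\prod_(i < n) lebesgue_measure (A i))%E.
Proof.
elim: n A => [|n IH] A mA.
  by rewrite big_ord0 /= diracE mem_set//= => -[].
rewrite big_ord_recl -(IH (fun i => A (lift ord0 i)))// /= /pushforward.
set B := [set x : 'rV[R]_n | forall i, A (lift ord0 i) (x 0 i)].
have mB : measurable B := measurable_rV_box (fun i => mA (lift ord0 i)).
rewrite -(@product_measure2E _ _ (measurableTypeR R) 'rV[R]_n R
  lebesgue_measure (@lebesgue_rV n) (A ord0) B (mA ord0) mB).
congr (product_measure2 _ _ _); apply/seteqP; split.
  move=> [r x]/= Arx; split=> [|i]; first by have := Arx ord0; rewrite mxE unlift_none.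
  by have := Arx (lift ord0 i); rewrite mxE liftK.
by move=> [r x]/= [Ar Ax] i; rewrite mxE; case: unliftP => [j ->|->].
Qed.

End lebesgue_rV.

Section geometry.
Context {R : realType}.

Definition L2norm n (K : set 'rV[R]_n) (f : 'rV[R]_n -> R) : \bar R :=
  'N[@lebesgue_rV R n]_2%:E[EFin \o (f \_ K)]%E.

Definition ediam n (A : set 'rV[R]_n) : \bar R :=
  ereal_sup [set (enorm (p.1 - p.2))%:E | p in A `*` A].

(* Federer's normalization: volume of the k-dimensional Euclidean ball of
   diameter diam A. As 0 ^ 0 = 1, k = 0 yields the counting measure. *)
Definition hausdorff_gauge n (k : nat) (A : set 'rV[R]_n) : \bar R :=
  (if A == set0 then 0
   else lebesgue_rV [set x : 'rV[R]_k | (enorm x <= 1)%R]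
        * (ediam A * 2^-1%:E) ^+ k)%E.

Definition hausdorff_content n (k : nat) (delta : R) (A : set 'rV[R]_n)
    : \bar R :=
  ereal_inf [set (\sum_(i <oo) hausdorff_gauge k (F i))%E | F in
    [set F : (set 'rV[R]_n)^nat |
      A `<=` \bigcup_i F i /\ forall i, (ediam (F i) <= delta%:E)%E]].

Definition hausdorff_measure n (k : nat) (A : set 'rV[R]_n) : \bar R :=
  ereal_sup [set hausdorff_content k delta A | delta in [set delta | 0 < delta]].

(* No finiteness of the measure of E is required, so that E may be only
   sigma-finite. *)
Definition rectifiable n (k : nat) (E : set 'rV[R]_n) : Prop :=
  exists f : nat -> 'rV[R]_k -> 'rV[R]_n,
    (forall i, exists L : R,
       forall x y, enorm (f i x - f i y) <= L * enorm (x - y)) /\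
    hausdorff_measure k (E `\` \bigcup_i range (f i)) = 0%E.

Definition boundary n (K : set 'rV[R]_n) : set 'rV[R]_n :=
  closure K `\` interior K.

Definition lipschitz_within n (L : R) (K : set 'rV[R]_n) (u : 'rV[R]_n -> R) :=
  forall x y, K x -> K y -> `|u x - u y| <= L * enorm (x - y).

Definition segment n (a b : 'rV[R]_n) : set 'rV[R]_n :=
  [set (1 - t) *: a + t *: b | t in `[0, 1]].

Definition convex_on_segments n (K : set 'rV[R]_n) (u : 'rV[R]_n -> R) :=
  forall a b, segment a b `<=` K -> convex_function (segment a b) u.

(* An arbitrary value is taken for the partial derivatives that do not exist. *)
Definition gradient n (u : 'rV[R]_n -> R) (x : 'rV[R]_n) : 'rV[R]_n :=
  \row_i 'D_(delta_mx 0 i) u x.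

End geometry.

(* Main.v *)
From HB Require Import structures.
Require Import Defs.
From mathcomp Require Import all_boot all_order all_algebra.
From mathcomp Require Import all_classical all_reals all_analysis.
From mathcomp Require Import measurable_realfun lra ring.
Import Order.TTheory GRing.Theory Num.Theory.
Import numFieldNormedType.Exports.

(** Write [w = u - v] and fix a coordinate direction [e] and a step [delta].
   At a point [x] such that the segment from [x - delta e] to [x + delta e]
   lies in [K], convexity places the partial derivatives of [u] and [v] between
   their backward and forward slopes of step [delta]. Hence the partial
   derivative of [w] at [x] differs from [(w (x + delta e) - w x) / delta] by at
   most the sum of the second differences of [u] and [v], divided by [delta].
   Squaring and integrating:
   - the difference quotient contributes at most a constant times
     [delta ^- 2 * A], where [A] is the squared L2 norm of [w], because Lebesgue
     measure is invariant under translations;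
   - the second differences are nonnegative and of order [L delta], so their
     squares are controlled by their integrals; these telescope
     (integral_second_diff), up to the points of [K] at which the segment leaves
     [K], each of which costs at most [2 L delta].
   At the points of [K] at which the segment leaves [K] the partial derivative
   of [w] is merely bounded by [2 L]. Such a segment meets the boundary of [K]
   (strip_boundary), so these points lie within [delta] of the boundary along
   [e], and covering the boundary by small sets shows that their volume is at
   most a constant times [delta * H], where [H] is the Hausdorff measure of the
   boundary (strip_measure). Altogether, for every [delta > 0], the squared L2
   norm of the gradient of [w] is at most a constant times
   [delta ^- 2 * A + L ^ 2 * H * delta], and the best choice of [delta] gives
   the inequality (optimize_step).

   When [H] is finite, the estimate of second differences also shows, through
   Fatou's lemma, that partial derivatives exist almost everywhere in the interior of [K]
   (negligible_not_derivable), so the values attributed to missing derivatives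
   are harmless there. On the boundary the gradients depend on the values of
   [u] and [v] outside [K], but a rectifiable boundary has zero volume
   (rectifiable_negligible).

   When [H] is infinite, the right-hand side is infinite unless [L = 0] or
   [A = 0]; in these two cases both gradients agree throughout the interior of
   [K]. *)

Set Implicit Arguments.
Unset Strict Implicit.
Unset Printing Implicit Defensive.

Local Open Scope classical_set_scope.
Local Open Scope ring_scope.

(** * Borel sets and translations in R^n *)

Section borel_rV.
Context {R : realType} {n : nat}.
Implicit Types (A K : set 'rV[R]_n).

Lemma open_measurable_rV A : open A -> measurable A.
Proof.
move=> oA.
pose box (p : 'rV[rat]_n * nat) : set 'rV[R]_n := [set x | forall i,
  `]ratr (p.1 0 i) - p.2.+1%:R^-1, ratr (p.1 0 i) + p.2.+1%:R^-1[%classic (x 0 i)].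
have -> : A = \bigcup_(p : 'rV[rat]_n * nat)
    (if asbool (box p `<=` A) then box p else set0).
  apply/seteqP; split=> [x Ax|x [p _]]; last by case: ifPn => // /asboolP; apply.
  have /nbhs_ballP[e /= e0 xeA] : nbhs x A by exact: open_nbhs_nbhs.
  have [m [r rE /andP[r0 re]]] : exists m : nat,
      exists2 r : R, r = m.+1%:R^-1 & 0 < r < e / 2.
    have /ltr_add_invr[m] : 0 < e / 2 by rewrite divr_gt0.
    by rewrite add0r => me; exists m, m.+1%:R^-1; rewrite ?me ?invr_gt0 ?andbT.
  have /choice[q qP] (i : 'I_n) : exists q : rat,
      ratr q \in `]x 0 i - r, x 0 i + r[.
    by apply: rat_in_itvoo; lra.
  have qE i : (\row_j q j) 0 i = q i by rewrite mxE.
  exists ((\row_i q i), m) => //; case: asboolP => [_ i /=|].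
    have := qP i; rewrite /= !in_itv/= qE -rE => /andP[? ?].
    by apply/andP; split; lra.
  case=> y ym; apply: xeA; split=> // i j; rewrite ord1 /ball/=.
  have := ym j; have := qP j; rewrite /= !in_itv/= qE -rE ltr_norml.
  by move=> /andP[? ?] /andP[? ?]; apply/andP; split; lra.
apply: countable_bigcupT_measurable => // -[p m]; case: ifPn => // _.
exact: (measurable_rV_box (fun i => measurable_itv _)).
Qed.

Lemma closed_measurable_rV A : closed A -> measurable A.
Proof.
move=> cA; rewrite -[A]setCK; apply: measurableC; apply: open_measurable_rV.
by rewrite openC.
Qed.

Lemma subspace_continuous_measurable_rV K (f : 'rV[R]_n -> R) :
  measurable K -> {within K, continuous f} -> measurable_fun K f.
Proof.
move=> mK /continuousP cf.
apply: (measurability _ (RGenOpens.measurableE R)) => _ [_ [a [b ->] <-]].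
have /open_subspaceP[V oV VK] : open (f @^-1` `]a, b[ : set (subspace K)).
  exact/cf/interval_open.
by rewrite setIC -VK; apply: measurableI => //; exact: open_measurable_rV.
Qed.

Lemma measurable_translation (c : 'rV[R]_n) :
  measurable_fun setT (fun x : 'rV[R]_n => x + c).
Proof.
apply: measurable_fun_rV => i.
under eq_fun do rewrite mxE.
by apply: measurable_funD; [exact: measurable_coor|exact: measurable_cst].
Qed.

Lemma sigma_finite_lebesgue_rV : sigma_finite setT (@lebesgue_rV R n).
Proof.
exists (fun m : nat => [set x : 'rV[R]_n | forall i,
    `]- m%:R, m%:R[%classic (x 0 i)]).
  apply/seteqP; split=> [x _|//].
  exists (Num.truncn (\sum_i `|x 0 i|)).+1 => // i.
  rewrite /= in_itv/= -ltr_norml.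
  apply: le_lt_trans (truncnS_gt _).
  by rewrite (bigD1 i)//= lerDl sumr_ge0.
move=> m; split; first exact: (measurable_rV_box (fun i => measurable_itv _)).
have -> := @lebesgue_rV_box R n (fun=> `]- m%:R, m%:R[%classic)
  (fun i => measurable_itv _).
rewrite ltey_eq prode_fin_num// => i _.
by rewrite lebesgue_measure_itv/=; case: ifPn.
Qed.

HB.instance Definition _ := Measure_isSigmaFinite.Build _ _ _
  (@lebesgue_rV R n) sigma_finite_lebesgue_rV.

End borel_rV.

Lemma lebesgue_measure_translation (R : realType) (c : R) (A : set R) :
  measurable A ->
  lebesgue_measure ((fun x => x + c) @^-1` A) = lebesgue_measure A.
Proof.
move=> mA.
have mc : measurable_fun [set: measurableTypeR R] (fun x => x + c).
  by apply: measurable_funD => //; exact: measurable_cst.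
pose m' := @measure_function_pushforward__canonical__measure_function_Measure
  _ _ (measurableTypeR R) (measurableTypeR R) _ (@lebesgue_measure R) _ mc.
apply/esym; apply: (@lebesgue_measure_unique R m') => // _ [[a b] _ <-].
rewrite /m'/= /pushforward.
have -> : (fun x => x + c) @^-1` `]a, b] = `]a - c, b - c]%classic.
  by apply/seteqP; split=> x /=; rewrite !in_itv/= ltrBlDr lerBrDr.
rewrite !lebesgue_measure_itv/= !lte_fin ltrD2r; case: ifPn => // _.
by rewrite -!EFinD; congr EFin; lra.
Qed.

(** By induction on the dimension: a translated product measure agrees with the
   product measure on rectangles. *)
Lemma lebesgue_rV_translation (R : realType) (n : nat) (c : 'rV[R]_n)
    (A : set 'rV[R]_n) : measurable A ->
  lebesgue_rV ((fun x => x + c) @^-1` A) = lebesgue_rV A.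
Proof.
elim: n c A => [|n IH] c A mA.
  by congr lebesgue_rV; apply/seteqP; split=> x /=; rewrite [x + c]thinmx0 [x]thinmx0.
rewrite /= /pushforward.
pose s := c 0 ord0; pose t : 'rV[R]_n := \row_i c 0 (lift ord0 i).
pose T (p : measurableTypeR R * 'rV[R]_n) : measurableTypeR R * 'rV[R]_n :=
  (p.1 + s, p.2 + t).
have mT : measurable_fun setT T.
  apply: measurable_fun_pair.
    by apply: measurable_funD; [exact: measurable_fst|exact: measurable_cst].
  exact: (measurableT_comp (measurable_translation t) measurable_snd).
pose p2 : {measure set (measurableTypeR R * 'rV[R]_n) -> \bar R} :=
  product_measure2 (@lebesgue_measure R) (@lebesgue_rV R n).
pose p1 := product_measure1 (@lebesgue_measure R) (@lebesgue_rV R n).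
have p1_unique := @product_measure_unique _ _ (measurableTypeR R) 'rV[R]_n R
  (@lebesgue_measure R) (@lebesgue_rV R n).
pose q2 : {measure set (measurableTypeR R * 'rV[R]_n) -> \bar R} :=
  @measure_function_pushforward__canonical__measure_function_Measure
  _ _ _ _ _ p2 _ mT.
set B : set (measurableTypeR R * 'rV[R]_n) := @row_cons R n @^-1` A.
have mB : measurable B by rewrite -[X in measurable X]setTI; exact: measurable_row_cons.
have e1 : p1 B = p2 B.
  by apply: (p1_unique p2) => // C D mC mD; exact: product_measure2E.
have e2 : p1 B = q2 B.
  apply: (p1_unique q2) => // C D mC mD; rewrite /q2/= /pushforward.
  have -> : T @^-1` (C `*` D) =
    ((fun x => x + s) @^-1` C) `*` ((fun x => x + t) @^-1` D) by [].
  rewrite product_measure2E.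
  - by congr (_ * _)%E; [exact: lebesgue_measure_translation|exact: IH].
  - rewrite -[X in measurable X]setTI.
    have : measurable_fun [set: measurableTypeR R] (fun x : measurableTypeR R => x + s).
      by apply: measurable_funD => //; exact: measurable_cst.
    by apply.
  - by rewrite -[X in measurable X]setTI; exact: measurable_translation.
rewrite -[RHS]/(p2 B) -e1 e2 -[RHS]/(p2 (T @^-1` B)).
rewrite -[LHS]/(p2 (@row_cons R n @^-1` ((fun x => x + c) @^-1` A))).
suff -> : @row_cons R n @^-1` ((fun x => x + c) @^-1` A) = T @^-1` B by [].
apply/seteqP; split=> -[r x]/=; congr A; apply/rowP => i; rewrite !mxE;
  by case: unliftP => [j ->|->]; rewrite ?mxE.
Qed.

(** * Hausdorff measure and Lebesgue measure *)

Section enorm.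
Context {R : realType} {n : nat}.
Implicit Types x y : 'rV[R]_n.

Lemma enorm_ge0 x : 0 <= enorm x. Proof. exact: sqrtr_ge0. Qed.

Lemma coord_le_enorm x i : `|x 0 i| <= enorm x.
Proof.
rewrite -sqrtr_sqr ler_wsqrtr// (bigD1 i)//= lerDl.
by apply: sumr_ge0 => j _; exact: sqr_ge0.
Qed.

Lemma enorm_le_sum x : enorm x <= \sum_i `|x 0 i|.
Proof.
have s0 : 0 <= \sum_i `|x 0 i| by apply: sumr_ge0.
rewrite -(ger0_norm s0) -sqrtr_sqr ler_wsqrtr// expr2 mulr_suml.
apply: ler_sum => i _; rewrite -real_normK ?num_real// expr2 ler_wpM2l//.
by rewrite (bigD1 i)//= lerDl sumr_ge0.
Qed.

Lemma enorm_delta (s : R) i : enorm (s *: delta_mx 0 i : 'rV[R]_n) = `|s|.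
Proof.
rewrite /enorm (bigD1 i)//= !mxE !eqxx/= mulr1 big1 ?addr0 ?sqrtr_sqr//.
by move=> j ji; rewrite !mxE (negPf ji) andbF mulr0 expr0n.
Qed.

Lemma enormN x : enorm (- x) = enorm x.
Proof. by rewrite /enorm; under eq_bigr do rewrite mxE sqrrN. Qed.

End enorm.

Section volume.
Context {R : realType}.
Implicit Types n k : nat.

Lemma lebesgue_rV_cbox n (c : 'rV[R]_n) (r : 'I_n -> R) : (forall i, 0 <= r i) ->
  lebesgue_rV [set x : 'rV[R]_n | forall i, `[c 0 i - r i, c 0 i + r i]%classic (x 0 i)]
  = (\prod_i (2 * r i))%:E.
Proof.
move=> r0.
rewrite (@lebesgue_rV_box R n (fun i => `[c 0 i - r i, c 0 i + r i]%classic));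
  last by move=> i; exact: measurable_itv.
rewrite -prodEFin; apply: eq_bigr => i _; rewrite lebesgue_measure_itv/= lte_fin.
case: ifPn => [_|]; first by rewrite -EFinD; congr EFin; lra.
by rewrite -leNgt => h; congr EFin; have := r0 i; lra.
Qed.

Lemma measurable_unit_ball k : measurable [set x : 'rV[R]_k | enorm x <= 1].
Proof.
have -> : [set x : 'rV[R]_k | enorm x <= 1] =
    (fun x : 'rV[R]_k => \sum_i x 0 i ^+ 2) @^-1` `]-oo, 1]%classic.
  apply/seteqP; split=> x; rewrite /= in_itv/= /enorm => h.
    by rewrite -(@ler_sqrt _ _ 1)// sqrtr1.
  by rewrite -sqrtr1 ler_wsqrtr.
rewrite -[X in measurable X]setTI.
suff : measurable_fun setT (fun x : 'rV[R]_k => \sum_i x 0 i ^+ 2).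
  by apply => //; exact: measurable_itv.
apply: measurable_sum => i; apply: measurable_funX; exact: measurable_coor.
Qed.

(** The bound is the volume of an inscribed cube. *)
Lemma unit_ball_volume_ge k :
  (((2 / k.+1%:R) ^+ k)%:E <= lebesgue_rV [set x : 'rV[R]_k | (enorm x <= 1)%R])%E.
Proof.
pose r (_ : 'I_k) : R := k.+1%:R^-1.
have r0 i : 0 <= r i by rewrite invr_ge0.
have := @lebesgue_rV_cbox k 0 r r0.
rewrite /r prodr_const card_ord => <-.
apply: le_measure.
- rewrite inE; exact: (@measurable_rV_box _ _ (fun i => `[_, _]%classic)).
- by rewrite inE; exact: measurable_unit_ball.
move=> x /= xr; apply: le_trans (enorm_le_sum x) _.
apply: (@le_trans _ _ (\sum_(i < k) k.+1%:R^-1)).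
  apply: ler_sum => i _; have := xr i; rewrite in_itv/= mxE sub0r add0r.
  by rewrite -ler_norml.
rewrite sumr_const card_ord -[X in X <= _]mulr_natr mulrC ler_pdivrMr ?ltr0n//.
by rewrite mul1r ler_nat.
Qed.


(** The points from which [F] can be reached by moving by at most [delta] along
   the [i]-th axis. *)
Definition strip n (F : set 'rV[R]_n) (i : 'I_n) (delta : R) : set 'rV[R]_n :=
  [set x | exists2 s : R, `|s| <= delta & F (x + s *: delta_mx 0 i)].

Definition strip_const k : R := 4 * (2 * k.+1%:R) ^+ k.

Lemma strip_const_gt0 k : 0 < strip_const k.
Proof. by rewrite mulr_gt0// exprn_gt0// mulr_gt0// ltr0n. Qed.

Lemma hausdorff_gauge_ge0 n k (F : set 'rV[R]_n) : (0 <= hausdorff_gauge k F)%E.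
Proof.
rewrite /hausdorff_gauge; case: ifPn => // /set0P[p Fp].
apply: mule_ge0 => //; apply: expe_ge0; apply: mule_ge0; last by rewrite lee_fin.
apply: le_trans (ereal_sup_ubound _); last by exists (p, p).
by rewrite lee_fin enorm_ge0.
Qed.

Lemma hausdorff_measure_ge0 n k (B : set 'rV[R]_n) :
  (0 <= hausdorff_measure k B)%E.
Proof.
apply: ereal_sup_ge; exists (hausdorff_content k 1 B); first by exists 1 => /=.
apply: le_ereal_inf_tmp => _ [F [_ _] <-].
by apply: nneseries_ge0 => m _ _; exact: hausdorff_gauge_ge0.
Qed.

Lemma ediam_fin n (F : set 'rV[R]_n) (delta : R) : F !=set0 ->
  (ediam F <= delta%:E)%E ->
  exists rho : R, [/\ 0 <= rho, rho <= delta, ediam F = rho%:E &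
    forall x y, F x -> F y -> enorm (x - y) <= rho].
Proof.
move=> [p Fp] Fd.
have ub x y : F x -> F y -> ((enorm (x - y))%:E <= ediam F)%E.
  by move=> Fx Fy; apply: ereal_sup_ubound; exists (x, y).
have d0 : (0 <= ediam F)%E.
  by apply: le_trans (ub p p Fp Fp); rewrite lee_fin enorm_ge0.
have dE : ediam F = (fine (ediam F))%:E.
  by rewrite fineK// ge0_fin_numE//; apply: le_lt_trans Fd _; rewrite ltry.
exists (fine (ediam F)); split => //.
- exact: fine_ge0.
- by rewrite -lee_fin -dE.
- by move=> x y Fx Fy; rewrite -lee_fin -dE; exact: ub.
Qed.

(** The strip over a set of diameter [rho <= delta] lies in a box with one side
   of order [delta] and [k] sides [2 * rho]. *)
Lemma strip_piece k (i : 'I_k.+1) (delta : R) (F : set 'rV[R]_k.+1) :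
  0 < delta -> (ediam F <= delta%:E)%E ->
  exists G, [/\ measurable G, strip F i delta `<=` G &
    (lebesgue_rV G <= (strip_const k * delta)%:E * hausdorff_gauge k F)%E].
Proof.
move=> d0 Fd; have [->|/set0P F0] := eqVneq F set0.
  exists set0; split=> [|x [s _ []]|]; first exact: measurable0.
  rewrite measure0 mule_ge0// ?hausdorff_gauge_ge0// lee_fin.
  by rewrite mulr_ge0// ltW// strip_const_gt0.
have [rho [rho0 rhod dF Fle]] := ediam_fin F0 Fd.
have [p Fp] := F0.
pose r (j : 'I_k.+1) : R := if j == i then delta + rho else rho.
exists [set x : 'rV[R]_k.+1 | forall j, `[p 0 j - r j, p 0 j + r j]%classic (x 0 j)]; split.
- exact: (@measurable_rV_box _ _ (fun j => `[p 0 j - r j, p 0 j + r j]%classic)).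
- move=> x [s sd Fx] j.
  have := le_trans (coord_le_enorm _ j) (Fle _ _ Fx Fp).
  rewrite !mxE /= in_itv/= /r; have [->|ji] := eqVneq j i.
    rewrite mulr1; move: sd; rewrite !ler_norml => /andP[? ?] /andP[? ?].
    by apply/andP; split; lra.
  rewrite mulr0 addr0 ler_norml => /andP[? ?].
  by apply/andP; split; lra.
rewrite lebesgue_rV_cbox; last by move=> j; rewrite /r; case: ifPn => _; lra.
rewrite (bigD1 i)//= {1}/r eqxx.
rewrite (eq_bigr (fun=> 2 * rho)); last by move=> j ji; rewrite /r (negPf ji).
rewrite prodr_const cardC1 card_ord /=.
rewrite /hausdorff_gauge ifF; last by apply/negbTE/set0P.
rewrite dF -EFinM -EFin_expe.
apply: (@le_trans _ _ ((strip_const k * delta)%:E *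
   (((2 / k.+1%:R) ^+ k)%:E * ((rho / 2) ^+ k)%:E))%E); last first.
  apply: lee_wpmul2l; first by rewrite lee_fin mulr_ge0// ltW// strip_const_gt0.
  by apply: lee_wpmul2r; rewrite ?unit_ball_volume_ge// lee_fin exprn_ge0// divr_ge0.
rewrite -!EFinM lee_fin /strip_const.
have e : (2 * rho) ^+ k =
    (2 * k.+1%:R) ^+ k * (2 / k.+1%:R) ^+ k * (rho / 2) ^+ k.
  by rewrite -!exprMn; congr (_ ^+ k); field; rewrite nat1r pnatr_eq0.
apply: (@le_trans _ _ (4 * delta * (2 * rho) ^+ k)); last first.
  by rewrite e le_eqVlt; apply/orP; left; apply/eqP; ring.
by rewrite ler_wpM2r ?exprn_ge0 ?mulr_ge0//; lra.
Qed.

(** The same bound for any [B], up to an error [eta], by summing over a cover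
   that is nearly optimal for the Hausdorff measure. *)
Lemma strip_cover k (i : 'I_k.+1) (delta eta : R) (B : set 'rV[R]_k.+1) :
  0 < delta -> 0 < eta -> hausdorff_measure k B \is a fin_num ->
  exists G, [/\ measurable G, strip B i delta `<=` G &
    (lebesgue_rV G <=
      (strip_const k * delta)%:E * (hausdorff_measure k B + eta%:E))%E].
Proof.
move=> d0 eta0 Hfin.
have cH : (hausdorff_content k delta B <= hausdorff_measure k B)%E.
  by apply: ereal_sup_ubound; exists delta.
have c0 : (0 <= hausdorff_content k delta B)%E.
  apply: le_ereal_inf_tmp => _ [F [_ _] <-].
  by apply: nneseries_ge0 => n _ _; exact: hausdorff_gauge_ge0.
have cfin : hausdorff_content k delta B \is a fin_num.
  by rewrite ge0_fin_numE// (le_lt_trans cH)// ltey_eq Hfin.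
have [_ [F [BF Fd] <-] Flt] := lb_ereal_inf_adherent eta0 cfin.
have /choice[G GP] n := strip_piece i d0 (Fd n).
exists (\bigcup_n G n); split.
- by apply: bigcupT_measurable => n; case: (GP n).
- move=> x [s sd /BF[n _ Fn]]; exists n => //.
  by have [_ + _] := GP n; apply; exists s.
have mG n : measurable (G n) by case: (GP n).
apply: le_trans.
  by apply: measure_sigma_subadditive; [exact: mG|exact: bigcupT_measurable|].
have C0 : (0 <= (strip_const k * delta)%:E)%E.
  by rewrite lee_fin mulr_ge0// ltW// strip_const_gt0.
apply: (@le_trans _ _
    (\sum_(n <oo) ((strip_const k * delta)%:E * hausdorff_gauge k (F n)))%E).
  by apply: lee_nneseries => // n _; have [_ _ h] := GP n; exact: h.
rewrite nneseriesZl//; last by move=> n _; exact: hausdorff_gauge_ge0.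
apply: lee_wpmul2l => //; apply: le_trans (ltW Flt) _.
by rewrite leeD2r.
Qed.

(** The strip over [B] is a body of thickness of order [delta] over a surface,
   so its volume is at most of order [delta] times the area of [B]. *)
Lemma strip_measure k (i : 'I_k.+1) (delta : R) (A B : set 'rV[R]_k.+1) :
  0 < delta -> measurable A -> A `<=` strip B i delta ->
  (lebesgue_rV A <= (strip_const k * delta)%:E * hausdorff_measure k B)%E.
Proof.
move=> d0 mA AB.
have C0 : 0 < strip_const k * delta by rewrite mulr_gt0// strip_const_gt0.
have H0 := hausdorff_measure_ge0 k B.
have [Hfin|] := boolP (hausdorff_measure k B \is a fin_num); last first.
  by rewrite ge0_fin_numE// -leNgt leye_eq => /eqP->; rewrite gt0_muley ?lte_fin// leey.
rewrite -lee_pdivrMl//; apply/lee_addgt0Pr => eta eta0.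
have [G [mG BG muG]] := strip_cover i d0 eta0 Hfin.
rewrite lee_pdivrMl//; apply: le_trans muG.
by apply: le_measure; rewrite ?inE//; exact: subset_trans BG.
Qed.

Lemma negligible_small_cover n (B : set 'rV[R]_n) :
  (forall e : R, 0 < e -> exists G, [/\ measurable G, B `<=` G &
    (lebesgue_rV G <= e%:E)%E]) ->
  (@lebesgue_rV R n).-negligible B.
Proof.
move=> cov.
have /choice[G GP] (m : nat) : exists G, [/\ measurable G, B `<=` G &
    (lebesgue_rV G <= (m.+1%:R^-1)%:E)%E].
  by apply: cov; rewrite invr_gt0 ltr0n.
have mG : measurable (\bigcap_m G m).
  by apply: bigcapT_measurable => m; case: (GP m).
exists (\bigcap_m G m); split => //; last first.
  by move=> x Bx m _; case: (GP m) => _ + _; apply.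
apply/eqP; rewrite -measure_le0; apply/lee_addgt0Pr => e e0; rewrite add0e.
have [m] := ltr_add_invr e0; rewrite add0r => /ltW me.
apply: (@le_trans _ _ (lebesgue_rV (G m))).
  by apply: le_measure; rewrite ?inE//; [case: (GP m)|exact: bigcap_inf].
by case: (GP m) => _ _ /le_trans; apply; rewrite lee_fin.
Qed.

Lemma hausdorff_measure0_negligible k (B : set 'rV[R]_k.+1) :
  hausdorff_measure k B = 0%E -> (@lebesgue_rV R k.+1).-negligible B.
Proof.
move=> HB0; apply: negligible_small_cover => e e0.
have C0 := strip_const_gt0 k.
have [|||G [mG BG muG]] := @strip_cover k ord0 1 (e / strip_const k) B.
- by [].
- by rewrite divr_gt0.
- by rewrite HB0.
exists G; split => //.
  by move=> x Bx; apply: BG; exists 0; rewrite ?normr0// scale0r addr0.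
by move: muG; rewrite HB0 add0e -EFinM mulr1 mulrCA divff ?gt_eqF// mulr1.
Qed.

(** A unit cube of R^k is cut into [N ^ k] cubes of side [N^-1]; their images
   lie in [N ^ k] boxes of volume of order [N ^- k.+1]. *)
Lemma lipschitz_cube_negligible k (f : 'rV[R]_k -> 'rV[R]_k.+1) (L : R)
    (p : 'rV[R]_k) :
  (forall x y, enorm (f x - f y) <= L * enorm (x - y)) ->
  (@lebesgue_rV R k.+1).-negligible
    (f @` [set x : 'rV[R]_k | forall i, p 0 i <= x 0 i < p 0 i + 1]).
Proof.
move=> fL; apply: negligible_small_cover => e e0.
pose c := (2 * (`|L| * k%:R)) ^+ k.+1.
have c0 : 0 <= c by rewrite exprn_ge0 ?mulr_ge0.
(* The [N ^ k] boxes have total volume [c / N], hence the choice of [N]. *)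
have [n] : exists n : nat, n.+1%:R^-1 < e / (c + 1).
  have : 0 < e / (c + 1) by rewrite divr_gt0//; lra.
  by move=> /ltr_add_invr[n]; rewrite add0r; exists n.
set N := n.+1%:R => Ne.
have N0 : 0 < N by rewrite ltr0n.
pose r := `|L| * k%:R / N.
have r0 : 0 <= r by apply: divr_ge0; [rewrite mulr_ge0|exact: ltW].
pose center (j : {ffun 'I_k -> 'I_n.+1}) : 'rV[R]_k :=
  \row_i (p 0 i + (j i)%:R / N).
pose G (j : {ffun 'I_k -> 'I_n.+1}) := [set y : 'rV[R]_k.+1 | forall i,
  `[f (center j) 0 i - r, f (center j) 0 i + r]%classic (y 0 i)].
have mG j : measurable (G j).
  exact: (@measurable_rV_box _ _
    (fun i => `[f (center j) 0 i - r, f (center j) 0 i + r]%classic)).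
pose UG := \big[setU/set0]_j G j.
have mUG : measurable UG by exact: bigsetU_measurable.
have muUG : (lebesgue_rV UG <= \sum_j lebesgue_rV (G j))%E.
  suff : measurable UG /\ (lebesgue_rV UG <= \sum_j lebesgue_rV (G j))%E by case.
  rewrite /UG; elim/big_rec2 : _ => [|j y A _ [mA Ay]]; first by rewrite measure0.
  split; first exact: measurableU.
  by apply: (le_trans (measureU2 _ _ _)) => //; rewrite leeD2l.
exists UG; split => //.
  move=> _ [x xp <-].
  have jP (i : 'I_k) : (Num.truncn ((x 0 i - p 0 i) * N)%R < n.+1)%N.
    have /andP[? ?] := xp i.
    rewrite -(ltr_nat R); apply: (@le_lt_trans _ _ ((x 0 i - p 0 i) * N)).
      by rewrite truncn_le mulr_ge0 ?subr_ge0// ltW.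
    by rewrite -[X in _ < X]mul1r ltr_pM2r//; lra.
  pose j : {ffun 'I_k -> 'I_n.+1} := [ffun i => Ordinal (jP i)].
  rewrite /UG -bigcup_seq; exists j; first by rewrite /= mem_index_enum.
  move=> i; rewrite /= in_itv/= -ler_distl.
  have := coord_le_enorm (f x - f (center j)) i; rewrite !mxE => /le_trans; apply.
  apply: (le_trans (fL _ _)).
  apply: (@le_trans _ _ (`|L| * enorm (x - center j))).
    by rewrite ler_wpM2r ?enorm_ge0 ?ler_norm.
  rewrite /r -mulrA ler_wpM2l//; apply: le_trans (enorm_le_sum _) _.
  have -> : k%:R / N = \sum_(i < k) N^-1 :> R.
    by rewrite sumr_const card_ord mulr_natl.
  apply: ler_sum => l _; rewrite !mxE ffunE/=.
  have /andP[? ?] := xp l.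
  have q0 : 0 <= (x 0 l - p 0 l) * N by rewrite mulr_ge0 ?subr_ge0// ltW.
  have /andP[t1 t2] := truncn_itv q0.
  set t := (Num.truncn _)%:R in t1; rewrite -natr1 -/t in t2.
  have -> : x 0 l - (p 0 l + t / N) = ((x 0 l - p 0 l) * N - t) / N.
    by field; rewrite gt_eqF.
  rewrite normrM (ger0_norm (x := N^-1)) ?invr_ge0 ?(ltW N0)//.
  rewrite ler_piMl ?invr_ge0 ?(ltW N0)// ger0_norm ?subr_ge0//.
  by rewrite lerBlDl ltW.
apply: (le_trans muUG); rewrite (eq_bigr (fun=> ((2 * r) ^+ k.+1)%:E)); last first.
  move=> j _; rewrite lebesgue_rV_cbox//.
  by rewrite prodr_const card_ord.
rewrite sumEFin lee_fin sumr_const card_ffun !card_ord.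
have -> : (2 * r) ^+ k.+1 = c / N ^+ k.+1.
  by rewrite /c -exprVn -exprMn; congr (_ ^+ _); rewrite /r; ring.
rewrite -mulr_natr natrX -/N.
have N'0 : N != 0 by rewrite gt_eqF.
have -> : c / N ^+ k.+1 * N ^+ k = c / N.
  by rewrite exprS invfM mulrA -mulrA mulVf ?mulr1// expf_neq0.
apply: (@le_trans _ _ ((c + 1) / N)).
  by rewrite ler_wpM2r ?invr_ge0 ?(ltW N0)// lerDl.
by rewrite mulrC -ler_pdivlMr ?(ltW Ne)//; lra.
Qed.

Lemma rectifiable_negligible k (E : set 'rV[R]_k.+1) :
  rectifiable k E -> (@lebesgue_rV R k.+1).-negligible E.
Proof.
case=> f [fL HE].
have fneg m : (@lebesgue_rV R k.+1).-negligible (range (f m)).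
  have [L fmL] := fL m.
  pose p (z : 'rV[int]_k) : 'rV[R]_k := \row_i (z 0 i)%:~R.
  have pneg z := lipschitz_cube_negligible (p z) fmL.
  pose F n := if unpickle n is Some z
    then f m @` [set x : 'rV[R]_k | forall i, p z 0 i <= x 0 i < p z 0 i + 1]
    else set0.
  apply: (@negligibleS _ _ _ _ (\bigcup_n F n)); last first.
    apply: negligible_bigcup => n; rewrite /F; case: unpickle => [z|] //.
    exact: negligible_set0.
  move=> _ [x _ <-]; pose z : 'rV[int]_k := \row_i Num.floor (x 0 i).
  exists (pickle z) => //; rewrite /F pickleK; exists x => // i.
  rewrite !mxE; have /andP[-> ] := floor_itv (x 0 i).
  by rewrite intrD.
have Eneg := hausdorff_measure0_negligible HE.
apply: (@negligibleS _ _ _ _ ((E `\` \bigcup_i range (f i)) `|` \bigcup_i range (f i))).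
  by move=> x Ex; have [?|?] := pselect ((\bigcup_i range (f i)) x); [right|left].
by apply: negligibleU => //; exact: negligible_bigcup.
Qed.
End volume.

(** * Convex functions along a direction *)

Section convexity.
Context {R : realType} {n : nat}.
Implicit Types (K : set 'rV[R]_n) (u v : 'rV[R]_n -> R) (x e : 'rV[R]_n).

(** The direction is signed: segments running backwards along [e] are those of
   [- e]. *)
Definition fwd K e (delta : R) : set 'rV[R]_n :=
  [set x | forall s, 0 <= s <= delta -> K (x + s *: e)].

Definition core K e (delta : R) : set 'rV[R]_n :=
  fwd K e delta `&` fwd K (- e) delta.

Definition second_diff u e (delta : R) x : R :=
  u (x + delta *: e) + u (x - delta *: e) - 2 * u x.

Lemma fwdS K e (h delta : R) : h <= delta -> fwd K e delta `<=` fwd K e h.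
Proof.
move=> hd x Kx s /andP[s0 sh]; apply: Kx; rewrite s0/=; exact: le_trans hd.
Qed.

Lemma coreS K e (h delta : R) : h <= delta -> core K e delta `<=` core K e h.
Proof. by move=> hd x [? ?]; split; apply: fwdS; eauto. Qed.

Lemma coreP K e delta x : core K e delta x ->
  forall s, `|s| <= delta -> K (x + s *: e).
Proof.
move=> [Px Nx] s; rewrite ler_norml => /andP[s1 s2].
have [s0|s0] := leP 0 s; first by apply: Px; rewrite s0.
by rewrite -[s]opprK scaleNr -scalerN; apply: Nx; apply/andP; split; lra.
Qed.

Lemma coreI K e delta x : (forall s, `|s| <= delta -> K (x + s *: e)) ->
  core K e delta x.
Proof.
move=> Kx; split=> s /andP[s0 sd]; first by apply: Kx; rewrite ger0_norm.
by rewrite scalerN -scaleNr; apply: Kx; rewrite normrN ger0_norm.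
Qed.

Lemma convex_on_segmentsP K u a b (t : R) : convex_on_segments K u ->
  segment a b `<=` K -> 0 <= t <= 1 ->
  u (t *: a + (1 - t) *: b) <= t * u a + (1 - t) * u b.
Proof.
move=> cu abK /andP[t0 t1].
have sa : a \in segment a b.
  by rewrite inE; exists 0; rewrite /= ?in_itv/= ?lexx ?ler01// subr0 scale1r scale0r addr0.
have sb : b \in segment a b.
  by rewrite inE; exists 1; rewrite /= ?in_itv/= ?lexx ?ler01// subrr scale1r scale0r add0r.
exact: (cu a b abK (Itv01 t0 t1) a b sa sb).
Qed.

Variables (K : set 'rV[R]_n) (u : 'rV[R]_n -> R).
Hypothesis cu : convex_on_segments K u.

Lemma convex_chord e (h delta : R) x : fwd K e delta x ->
  0 <= h <= delta -> 0 < delta ->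
  delta * (u (x + h *: e) - u x) <= h * (u (x + delta *: e) - u x).
Proof.
move=> Kx /andP[h0 hd] d0.
have seg : segment (x + delta *: e) x `<=` K.
  move=> _ [t /= + <-]; rewrite in_itv/= => /andP[t0 t1].
  have -> : (1 - t) *: (x + delta *: e) + t *: x = x + ((1 - t) * delta) *: e.
    by rewrite scalerDr scalerA addrAC -scalerDl subrK scale1r.
  by apply: Kx; apply/andP; split; nra.
have t01 : 0 <= h / delta <= 1.
  by rewrite divr_ge0 ?(ltW d0)//= ler_pdivrMr// mul1r.
have := convex_on_segmentsP cu seg t01.
have -> : (h / delta) *: (x + delta *: e) + (1 - h / delta) *: x = x + h *: e.
  rewrite scalerDr scalerA divfK ?gt_eqF// scalerBl scale1r.
  by rewrite addrC addrA subrK.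
rewrite -(ler_pM2l d0) => /le_trans.
move=> /(_ (h * u (x + delta *: e) + (delta - h) * u x)); rewrite mulrDr.
have -> : delta * (h / delta * u (x + delta *: e)) = h * u (x + delta *: e).
  by field; rewrite gt_eqF.
have -> : delta * ((1 - h / delta) * u x) = (delta - h) * u x.
  by field; rewrite gt_eqF.
by move=> /(_ (lexx _)) ?; lra.
Qed.

Lemma second_diff_ge0 e delta x : core K e delta x -> 0 <= delta ->
  0 <= second_diff u e delta x.
Proof.
move=> Kx d0.
have seg : segment (x + delta *: e) (x - delta *: e) `<=` K.
  move=> _ [t /= + <-]; rewrite in_itv/= => /andP[t0 t1].
  have -> : (1 - t) *: (x + delta *: e) + t *: (x - delta *: e) =
      x + ((1 - 2 * t) * delta) *: e.
    rewrite !scalerDr addrACA -scalerDl subrK scale1r scalerN !scalerA -scalerBl.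
    by congr (_ + _ *: _); ring.
  by apply: (coreP Kx); rewrite ler_norml; apply/andP; split; nra.
have t01 : 0 <= (2^-1 : R) <= 1 by apply/andP; split; lra.
have := convex_on_segmentsP cu seg t01.
have -> : (2^-1 : R) *: (x + delta *: e) + (1 - 2^-1) *: (x - delta *: e) = x.
  have -> : 1 - 2^-1 = 2^-1 :> R by field.
  rewrite -scalerDr addrACA subrr addr0 -[X in X + X]scale1r -scalerDl scalerA.
  by rewrite (_ : 2^-1 * (1 + 1) = 1) ?scale1r//; field.
by rewrite /second_diff; lra.
Qed.

(** By monotonicity of slopes it is enough to compare those of the smaller of
   the two steps, whose difference is a second difference. *)
Lemma slope_le e (h h' : R) x : core K e (Num.max h h') x -> 0 < h -> 0 < h' ->
  h * (u x - u (x - h' *: e)) <= h' * (u (x + h *: e) - u x).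
Proof.
move=> Kx h0 h'0; set m := Num.min h h'.
have m0 : 0 < m by rewrite lt_min h0.
have mh : m <= h by rewrite ge_min lexx.
have mh' : m <= h' by rewrite ge_min lexx orbT.
have [Kx1 Kx2] : core K e m x.
  by apply: coreS Kx; rewrite le_max mh.
have sd := second_diff_ge0 (conj Kx1 Kx2) (ltW m0).
have [Px Nx] := Kx.
have c1 : h * (u (x + m *: e) - u x) <= m * (u (x + h *: e) - u x).
  apply: convex_chord => //; last by rewrite (ltW m0).
  by apply: fwdS Px; rewrite le_max lexx.
have c2 : h' * (u (x + m *: - e) - u x) <= m * (u (x + h' *: - e) - u x).
  apply: convex_chord => //; last by rewrite (ltW m0).
  by apply: fwdS Nx; rewrite le_max lexx orbT.
rewrite !scalerN in c2; rewrite /second_diff in sd.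
rewrite -(ler_pM2l m0).
set a := u (x + m *: e) in sd c1 *; set b := u (x - m *: e) in sd c2 *.
set c := u (x + h *: e) in c1 *; set d := u (x - h' *: e) in c2 *.
have e1 := ler_wpM2l (ltW h'0) c1.
have e2 := ler_wpM2l (ltW h0) c2.
have e3 : 0 <= h * h' * (a + b - 2 * u x) by rewrite mulr_ge0// mulr_ge0// ltW.
lra.
Qed.

(** A derivative is a limit of slopes of smaller steps on the same side. *)
Lemma derive_le_slope e (delta : R) x : derivable u x e -> 0 < delta ->
  fwd K e delta x -> delta * 'D_e u x <= u (x + delta *: e) - u x.
Proof.
move=> du d0 Kx; rewrite -ler_pdivlMl//.
have /cvg_dnbhs_at_right : (fun h => h^-1 *: ((u \o shift x) (h *: e) - u x)) @ 0^'
  --> 'D_e u x by [].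
move=> /cvgr_to_le; apply; near=> h.
have h0 : 0 < h by near: h; exact: nbhs_right_gt.
have hd : h <= delta by near: h; exact: nbhs_right_le.
rewrite /= [_ + x]addrC [X in X <= _]/(h^-1 * _).
rewrite ler_pdivrMl// mulrCA ler_pdivlMl//.
by apply: convex_chord => //; rewrite (ltW h0).
Unshelve. all: by end_near. Qed.

Lemma slope_le_derive e (delta : R) x : derivable u x e -> 0 < delta ->
  fwd K (- e) delta x -> u x - u (x - delta *: e) <= delta * 'D_e u x.
Proof.
move=> du d0 Kx; rewrite -ler_pdivrMl//.
have /cvg_dnbhs_at_left : (fun h => h^-1 *: ((u \o shift x) (h *: e) - u x)) @ 0^'
  --> 'D_e u x by [].
move=> /cvgr_to_ge; apply; near=> h.
have h0 : h < 0 by near: h; exact: nbhs_left_lt.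
have hd : - delta <= h by near: h; apply: nbhs_left_ge; rewrite oppr_lt0.
have := @convex_chord (- e) (- h) delta x Kx.
rewrite !scalerN scaleNr opprK => /(_ _ d0) c.
rewrite /= [_ + x]addrC [X in _ <= X]/(h^-1 * _).
rewrite ler_pdivrMl// mulrCA ler_ndivlMl//.
suff : delta * (u (x + h *: e) - u x) <= - h * (u (x - delta *: e) - u x) by lra.
by apply: c; apply/andP; split; lra.
Unshelve. all: by end_near. Qed.

(** A convex function on a line is derivable at a point as soon as its second
   differences there are small compared with the step, for some arbitrarily
   small steps: the slopes to the right of the point decrease to their infimum,
   which bounds the slopes to its left. *)
Lemma derivable_second_diff e (delta : R) x : 0 < delta -> core K e delta x ->
  (forall eps, 0 < eps -> exists2 h, 0 < h <= delta &
     second_diff u e h x <= h * eps) ->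
  derivable u x e.
Proof.
move=> d0 Kx small.
pose sr h := h^-1 * (u (x + h *: e) - u x).
pose sl h := h^-1 * (u x - u (x - h *: e)).
have Kh h : h <= delta -> core K e h x by move=> hd; exact: coreS Kx.
have lr h h' : 0 < h <= delta -> 0 < h' <= delta -> sl h' <= sr h.
  move=> /andP[h0 hd] /andP[h'0 h'd]; rewrite /sl /sr ler_pdivrMl// mulrCA ler_pdivlMl//.
  by apply: slope_le => //; apply: Kh; rewrite ge_max hd.
have srm h h' : 0 < h -> h <= h' -> h' <= delta -> sr h <= sr h'.
  move=> h0 hh' h'd; have h'0 := lt_le_trans h0 hh'.
  rewrite /sr ler_pdivrMl// mulrCA ler_pdivlMl//.
  by apply: convex_chord => //; [case: (Kh _ h'd)|rewrite (ltW h0)].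
have slm h h' : 0 < h -> h <= h' -> h' <= delta -> sl h' <= sl h.
  move=> h0 hh' h'd; have h'0 := lt_le_trans h0 hh'.
  have := @convex_chord (- e) h h' x (Kh _ h'd).2.
  rewrite !scalerN (ltW h0) hh' => /(_ isT h'0) c.
  rewrite /sl ler_pdivlMl// mulrCA ler_pdivrMl//; lra.
(* The derivative will be the infimum of the slopes to the right. *)
pose S := [set sr h | h in [set h | 0 < h <= delta]].
have dd : 0 < delta <= delta by rewrite d0 lexx.
have S0 : S !=set0 by exists (sr delta), delta.
have Slb h : 0 < h <= delta -> lbound S (sl h).
  by move=> hd _ [h' h'd <-]; exact: lr.
have hS : has_inf S by split => //; exists (sl delta); exact: Slb.
have ler h : 0 < h <= delta -> inf S <= sr h.
  by move=> hd; apply: ge_inf; [exact: hS.2|exists h].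
have gel h : 0 < h <= delta -> sl h <= inf S.
  by move=> hd; apply: lb_le_inf => //; exact: Slb.
apply/cvg_ex; exists (inf S); apply/cvgrPdist_le => eps eps0.
have [h /andP[h0 hd] sdh] := small eps eps0.
have hh : 0 < h <= delta by rewrite h0.
have slr : sr h <= sl h + eps.
  rewrite -(ler_pM2l h0) mulrDr /sr /sl !mulVKf ?gt_eqF//.
  by rewrite /second_diff in sdh; lra.
near=> t.
have th : `|t| <= h by near: t; apply: dnbhs0_le.
have t0 : t != 0 by near: t; exact: nbhs_dnbhs_neq.
suff : `|inf S - t^-1 * (u (x + t *: e) - u x)| <= eps by rewrite /= [_ + x]addrC.
have [tp|tn|tz] := ltgtP t 0; last by rewrite tz eqxx in t0.
- have tE : `|t| = - t by rewrite ltr0_norm.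
  have -> : t^-1 * (u (x + t *: e) - u x) = sl (- t).
    by rewrite /sl scaleNr opprK invrN; ring.
  rewrite tE in th; have tt : 0 < - t by lra.
  have := gel (- t); rewrite tt (le_trans th hd) => /(_ isT) g1.
  have g2 := slm (- t) h tt th hd; have g3 := ler h hh.
  by rewrite ger0_norm; lra.
- rewrite -/(sr t); rewrite gtr0_norm// in th.
  have := ler t; rewrite tn (le_trans th hd) => /(_ isT) g1.
  have g2 := srm t h tn th hd; have g3 := gel h hh.
  by rewrite ler0_norm; lra.
Unshelve. all: by end_near. Qed.

End convexity.

(** A segment on which there is no boundary point meets [K] and the interior of
   [K] in the same set, which is both closed and open in the segment. *)
Lemma strip_boundary (R : realType) n (K : set 'rV[R]_n) (i : 'I_n) (delta : R) :
  closed K -> 0 <= delta ->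
  K `\` core K (delta_mx 0 i) delta `<=` strip (boundary K) i delta.
Proof.
move=> cK d0 x [Kx nc]; apply: contrapT => nb; apply: nc; apply: coreI.
set e := delta_mx 0 i in nb *.
have nB s : `|s| <= delta -> ~ boundary K (x + s *: e).
  by move=> sd b; apply: nb; exists s.
pose f (s : R) := x + s *: e.
have cf : continuous f.
  by move=> s; apply: cvgD; [exact: cvg_cst|apply: cvgZr_tmp; exact: cvg_id].
suff {}h : `[- delta, delta]%classic `&` f @^-1` K = `[- delta, delta]%classic.
  move=> s; rewrite ler_norml => sd.
  by have [] : (`[- delta, delta]%classic `&` f @^-1` K) s by rewrite h /= in_itv.
apply: (@segment_connected R (- delta) delta).
- exists 0; split; first by rewrite /= in_itv/= oppr_le0 d0.
  by rewrite /f /= scale0r addr0.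
- exists (f @^-1` interior K).
    by apply: open_comp; [move=> s _; exact: cf|exact: open_interior].
  apply/seteqP; split=> s [sd Ks]; split => //; last exact: (interior_subset Ks).
  apply: contrapT => nK; apply: (nB s); first by move: sd; rewrite /= in_itv/= ler_norml.
  by split => //; exact: subset_closure.
- exists (f @^-1` K) => //; apply: closed_comp => // s _; exact: cf.
Qed.

(** * Integral estimates *)

Lemma ge0_integral_translation (R : realType) n (c : 'rV[R]_n)
    (D : set 'rV[R]_n) (f : 'rV[R]_n -> \bar R) :
  measurable D -> measurable_fun D f -> (forall x, D x -> 0 <= f x)%E ->
  (\int[@lebesgue_rV R n]_(x in D) f x =
   \int[@lebesgue_rV R n]_(x in (fun x => x + c)%R @^-1` D) f (x + c)%R)%E.
Proof.
move=> mD mf f0; have mc := @measurable_translation R n c.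
rewrite -(@ge0_integral_pushforward _ _ _ _ _ _ mc (@lebesgue_rV R n))//; last first.
  by move=> x; rewrite inE; exact: f0.
pose m := @measure_function_pushforward__canonical__measure_function_Measure
  _ _ _ _ _ (@lebesgue_rV R n) _ mc.
apply: (@eq_measure_integral _ _ _ _ m) => A mA _.
by rewrite /m /= /pushforward lebesgue_rV_translation.
Qed.

(** The integral of a nonnegative function is defined without measurability,
   as a supremum over simple functions; it is still monotone, up to null
   sets. *)
Lemma ge0_le_integral_negligible d (T : measurableType d) (R : realType)
    (mu : {measure set T -> \bar R}) (f g : T -> \bar R) (Z : set T) :
  (forall x, 0 <= f x)%E -> (forall x, 0 <= g x)%E -> measurable_fun setT g ->
  mu.-negligible Z -> (forall x, ~ Z x -> f x <= g x)%E ->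
  (\int[mu]_x f x <= \int[mu]_x g x)%E.
Proof.
move=> f0 g0 mg [N [mN N0 ZN]] fg.
pose h x := (g x + ((cst +oo : T -> \bar R) \_ N) x)%E.
have c0 x : (0 <= ((cst +oo : T -> \bar R) \_ N) x)%E.
  by apply: erestrict_ge0 => y _; exact: leey.
have h0 x : (0 <= h x)%E by rewrite adde_ge0.
have mh : measurable_fun setT h.
  apply: emeasurable_funD => //; apply/(measurable_restrictT _ mN).1.
  exact: measurable_cst.
have -> : (\int[mu]_x g x = \int[mu]_x h x)%E.
  apply: ge0_ae_eq_integral => //; exists N; split => // x /= nxh.
  apply: contrapT => Nx; apply: nxh => _.
  by rewrite /h patchE memNset// adde0.
rewrite !ge0_integralTE//; apply: ereal_sup_le => _ /= [s sf <-].
exists s => // x; apply: le_trans (sf x) _; rewrite /h patchE.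
case: ifPn => [_|xN].
  by rewrite addey// ?leey// gt_eqF// (lt_le_trans _ (g0 x))// ltNy0.
by rewrite adde0; apply: fg => /ZN Nx; rewrite mem_set in xN.
Qed.

Section estimates.
Context {R : realType} {k : nat}.
Notation n := k.+1.
Notation mu := (@lebesgue_rV R n).
Variables (K : set 'rV[R]_n) (L : R).
Hypotheses (cptK : compact K) (L0 : 0 <= L).

Lemma compact_rV_closed : closed K.
Proof. exact: compact_closed (@norm_hausdorff _ _) cptK. Qed.

Lemma measurable_compact_rV : measurable K.
Proof. exact: closed_measurable_rV compact_rV_closed. Qed.

Lemma compact_rV_bounded : exists2 M : R, 0 <= M &
  forall x, K x -> forall i, `|x 0 i| <= M.
Proof.
have [M [_ KM]] := compact_bounded cptK.
exists (`|M| + 1) => [|x Kx i]; first by rewrite addr_ge0.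
have : `|x| <= `|M| + 1.
  by apply: (KM (`|M| + 1)) => //; rewrite (le_lt_trans (ler_norm M))// ltrDl.
apply: le_trans; rewrite [X in _ <= X]/Num.norm/= mx_normrE.
exact: (le_bigmax _ (fun ij => `|x ij.1 ij.2|) (0, i)).
Qed.

Lemma compact_rV_finite : (mu K < +oo)%E.
Proof.
have [M M0 KM] := compact_rV_bounded.
have m0 (i : 'I_n) : 0 <= M by [].
have E := @lebesgue_rV_cbox R n 0 (fun=> M) m0.
apply: (@le_lt_trans _ _ (\prod_(i < n) (2 * M))%:E); last exact: ltry.
rewrite -E; apply: le_measure; rewrite ?inE.
- exact: measurable_compact_rV.
- exact: (@measurable_rV_box _ _ (fun=> `[_, _]%classic)).
- by move=> x Kx i; rewrite /= in_itv/= mxE sub0r add0r -ler_norml; exact: KM.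
Qed.

Lemma measurable_fwd e (delta : R) : measurable (fwd K e delta).
Proof.
apply: closed_measurable_rV.
have -> : fwd K e delta = \bigcap_(s in [set s | 0 <= s <= delta])
    ((fun x => x + s *: e) @^-1` K).
  by apply/seteqP; split=> x Kx s; exact: Kx.
apply: closed_bigI => s _.
have cs : continuous (fun x : 'rV[R]_n => x + s *: e).
  by move=> x; exact: (cvgD cvg_id (cvg_cst _)).
by apply: closed_comp => [x _|]; [exact: cs|exact: compact_rV_closed].
Qed.

Lemma measurable_core e (delta : R) : measurable (core K e delta).
Proof. by apply: measurableI; exact: measurable_fwd. Qed.

Lemma fwd_sub e (delta : R) : 0 <= delta -> fwd K e delta `<=` K.
Proof. by move=> d0 x /(_ 0); rewrite lexx d0 scale0r addr0; exact. Qed.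

Lemma core_sub e (delta : R) : 0 <= delta -> core K e delta `<=` K.
Proof. by move=> d0 x [Px _]; exact: fwd_sub Px. Qed.

Section one_function.
Variable u : 'rV[R]_n -> R.
Hypothesis Lu : lipschitz_within L K u.

Lemma measurable_lipschitz : measurable_fun K u.
Proof.
apply: subspace_continuous_measurable_rV; first exact: measurable_compact_rV.
apply/subspace_continuousP => x Kx; apply/cvgrPdist_le => eps eps0.
pose c := L * n%:R + 1.
have c0 : 0 < c by rewrite ltr_wpDl// mulr_ge0.
apply/nbhs_ballP; exists (eps / c); first by rewrite /= divr_gt0.
move=> y [_ xy] Ky; apply: (le_trans (Lu Kx Ky)).
have q0 : 0 < eps / c by rewrite divr_gt0.
apply: (@le_trans _ _ (c * (eps / c))); last by rewrite mulrCA divff ?mulr1// gt_eqF.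
move: q0 (xy : forall i j, _); set q := eps / c => q0 {}xy.
apply: (@le_trans _ _ (L * \sum_(i < n) q)).
  rewrite ler_wpM2l//; apply: le_trans (enorm_le_sum _) _.
  by apply: ler_sum => i _; rewrite !mxE ltW//; exact: xy.
have -> : \sum_(i < n) q = n%:R * q by rewrite sumr_const card_ord mulr_natl.
by rewrite mulrA ler_wpM2r// ?ltW// /c ltrDl.
Qed.

Lemma measurable_shift (c : 'rV[R]_n) (D : set 'rV[R]_n) : measurable D ->
  (forall x, D x -> K (x + c)) -> measurable_fun D (fun x => u (x + c)).
Proof.
move=> mD DK; apply: (measurable_comp (F := K)).
- exact: measurable_compact_rV.
- by move=> _ [x Dx <-]; exact: DK.
- exact: measurable_lipschitz.
- by apply: measurable_funTS; exact: measurable_translation.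
Qed.

Section direction.
Variables (e : 'rV[R]_n) (delta : R).
Hypotheses (e1 : forall s : R, enorm (s *: e) = `|s|) (d0 : 0 < delta).

Lemma fwd_end x : fwd K e delta x -> K (x + delta *: e).
Proof. by apply; rewrite lexx (ltW d0). Qed.

Lemma core_end x : core K e delta x -> K (x - delta *: e).
Proof. by case=> _ /(_ delta); rewrite lexx (ltW d0) scalerN; exact. Qed.

Lemma core_endr x : core K e delta x -> K (x + delta *: e).
Proof. by case=> /fwd_end. Qed.

Lemma enorm_fwd s x : enorm (x + s *: e - x) = `|s|.
Proof. by rewrite (addrC x) addrK e1. Qed.

Lemma enorm_bwd s x : enorm (x - s *: e - x) = `|s|.
Proof. by rewrite (addrC x) addrK enormN e1. Qed.

Lemma fwd_lip x : fwd K e delta x -> `|u (x + delta *: e) - u x| <= L * delta.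
Proof.
move=> Px; have := Lu (fwd_end Px) (fwd_sub (ltW d0) Px).
by rewrite enorm_fwd (gtr0_norm d0).
Qed.

Lemma measurable_second_diff : measurable_fun (core K e delta) (second_diff u e delta).
Proof.
have mU := measurable_core e delta.
apply: measurable_funB; first apply: measurable_funD.
- by apply: measurable_shift => // x; exact: core_endr.
- by apply: measurable_shift => // x; exact: core_end.
- apply: measurable_funM; first exact: measurable_cst.
  by apply: measurable_funS measurable_lipschitz;
    [exact: measurable_compact_rV|exact: core_sub (ltW d0)].
Qed.

Lemma second_diff_le x : core K e delta x -> second_diff u e delta x <= 2 * L * delta.
Proof.
move=> Ux; have [Px Nx] := Ux.
have := Lu (core_endr Ux) (core_sub (ltW d0) Ux).
have := Lu (core_end Ux) (core_sub (ltW d0) Ux).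
rewrite enorm_bwd enorm_fwd (gtr0_norm d0).
by rewrite !ler_norml /second_diff => /andP[? ?] /andP[? ?]; lra.
Qed.

(** Second differences are differences of first differences, so that over the
   whole line they telescope: what is left comes from the points at which only
   one of the two first differences is available, near the boundary. *)
Lemma integral_second_diff : convex_on_segments K u ->
  (\int[mu]_(x in core K e delta) (second_diff u e delta x)%:E <=
   (2 * L * delta)%:E * mu (K `\` core K e delta))%E.
Proof.
move=> cu.
set P := fwd K e delta; set Q := fwd K (- e) delta; set U := core K e delta.
have mP : measurable P by exact: measurable_fwd.
have mQ : measurable Q by exact: measurable_fwd.
have mU : measurable U by exact: measurable_core.
have mK := measurable_compact_rV.
have UP : U `<=` P by move=> x [].
have UQ : U `<=` Q by move=> x [].
have QK : Q `<=` K by exact: fwd_sub (ltW d0).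
(* The forward and backward first differences are shifted by [L * delta] to
   become nonnegative; [q] is a translate of [p], with the same integral. *)
pose p x := L * delta + (u (x + delta *: e) - u x).
pose q x := L * delta + (u x - u (x - delta *: e)).
have p0 x : P x -> 0 <= p x.
  by move=> /fwd_lip; rewrite ler_norml /p => /andP[? ?]; lra.
have p2 x : P x -> p x <= 2 * L * delta.
  by move=> /fwd_lip; rewrite ler_norml /p => /andP[? ?]; lra.
have QE : Q = (fun x => x - delta *: e) @^-1` P.
  apply/seteqP; split=> x Qx s /andP[s0 sd].
    rewrite /= -addrA addrC -scaleNr -scalerDl.
    rewrite addrC -[_ + s]opprK scaleNr -scalerN; apply: Qx.
    by apply/andP; split; lra.
  rewrite scalerN -scaleNr.
  have -> : x + - s *: e = (x - delta *: e) + (delta - s) *: e.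
    by rewrite -addrA -scaleNr -scalerDl; congr (_ + _ *: _); lra.
  by apply: Qx; apply/andP; split; lra.
have pq x : p (x - delta *: e) = q x by rewrite /p /q subrK.
have q0 x : Q x -> 0 <= q x by rewrite QE -pq => /p0.
have q2 x : Q x -> q x <= 2 * L * delta by rewrite QE -pq => /p2.
have mp : measurable_fun P p.
  apply: measurable_funD; first exact: measurable_cst.
  apply: measurable_funB; first by apply: measurable_shift => // x; exact: fwd_end.
  by apply: measurable_funS measurable_lipschitz => //; exact: fwd_sub (ltW d0).
have mq : measurable_fun Q q.
  apply: measurable_funD; first exact: measurable_cst.
  apply: measurable_funB; first exact: measurable_funS measurable_lipschitz.
  apply: measurable_shift => // x /(_ delta); rewrite scalerN; apply.
  by rewrite lexx (ltW d0).
have mEp : measurable_fun P (EFin \o p) by exact/measurable_EFinP.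
have mEq : measurable_fun Q (EFin \o q) by exact/measurable_EFinP.
have tr : (\int[mu]_(x in P) (p x)%:E = \int[mu]_(x in Q) (q x)%:E)%E.
  rewrite (@ge0_integral_translation _ _ (- (delta *: e)))//.
  by rewrite -QE; apply: eq_integral => x _; rewrite pq.
have bnd A : measurable A -> A `<=` Q ->
    (\int[mu]_(x in A) (q x)%:E <= (2 * L * delta)%:E * mu A)%E.
  move=> mA AQ; rewrite -integral_cst//; apply: ge0_le_integral => //.
  - by move=> x /AQ/q0; rewrite lee_fin.
  - exact: measurable_funS mEq.
  - by move=> x /AQ/q2; rewrite lee_fin.
have Ufin : (\int[mu]_(x in U) (q x)%:E \is a fin_num)%E.
  rewrite ge0_fin_numE; last by apply: integral_ge0 => x /UQ/q0; rewrite lee_fin.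
  apply: (le_lt_trans (bnd U mU UQ)); rewrite lte_mul_pinfty//.
    by rewrite lee_fin !mulr_ge0// ltW.
  apply: le_lt_trans compact_rV_finite; apply: le_measure; rewrite ?inE//.
  exact: subset_trans QK.
(* On [U] the second difference is [p - q]; the difference is avoided by adding
   the finite integral of [q] to both sides. *)
rewrite -(leeD2lE _ _ Ufin).
have -> : (\int[mu]_(x in U) (q x)%:E + \int[mu]_(x in U) (second_diff u e delta x)%:E
    = \int[mu]_(x in U) (p x)%:E)%E.
  rewrite -ge0_integralD//.
  - by apply: eq_integral => x _; rewrite -EFinD; congr EFin; rewrite /p /q /second_diff; lra.
  - by move=> x /UQ/q0; rewrite lee_fin.
  - exact: measurable_funS mEq.
  - by move=> x Ux; rewrite lee_fin; apply: (second_diff_ge0 cu) => //; exact: ltW.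
  - by apply/measurable_EFinP; exact: measurable_second_diff.
apply: (@le_trans _ _ (\int[mu]_(x in P) (p x)%:E)%E).
  by apply: ge0_subset_integral => // x /p0; rewrite lee_fin.
rewrite tr -(setDUK UQ) ge0_integral_setU//.
- rewrite leeD2l//; apply: le_trans (bnd _ _ _) _ => //; first exact: measurableD.
  rewrite lee_wpmul2l ?lee_fin ?mulr_ge0 ?(ltW d0)//; apply: le_measure; rewrite ?inE.
  + exact: measurableD.
  + exact: measurableD.
  + by move=> x [/QK].
- exact: measurableD.
- by rewrite setDUK.
- by move=> x; rewrite setDUK// => /q0; rewrite lee_fin.
- by apply/disj_setPS => x [Ux []].
Qed.

End direction.
End one_function.
End estimates.

Section directional.
Context {R : realType} {k : nat}.
Notation n := k.+1.
Notation mu := (@lebesgue_rV R n).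
Variables (K : set 'rV[R]_n) (L : R) (i : 'I_n).
Hypotheses (cptK : compact K) (L0 : 0 <= L).
Hypothesis Hfin : hausdorff_measure k (boundary K) \is a fin_num.
Let e : 'rV[R]_n := delta_mx 0 i.
Let e1 (s : R) : enorm (s *: e) = `|s|.
Proof. exact: enorm_delta. Qed.
Let H : R := fine (hausdorff_measure k (boundary K)).
Let C : R := strip_const k.

(** Where the segment of half-length [delta] around a point of [K] leaves [K],
   it crosses the boundary. *)
Lemma core_defect (delta : R) : 0 < delta ->
  (mu (K `\` core K e delta) <= (C * delta * H)%:E)%E.
Proof.
move=> d0; rewrite EFinM fineK//; apply: (strip_measure (i := i)) => //.
  apply: measurableD; first exact: measurable_compact_rV.
  exact: measurable_core.
by apply: strip_boundary; [exact: compact_rV_closed|exact: ltW].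
Qed.

Lemma interior_core x : interior K x -> exists2 delta, 0 < delta & core K e delta x.
Proof.
move=> /nbhs_ballP[r /= r0 rK]; exists (r / 2); first by rewrite divr_gt0.
apply: coreI => s sr; apply: rK; split => // a b; rewrite /ball/= !ord1 !mxE.
rewrite opprD addrA subrr sub0r normrN eqxx/=.
apply: (@le_lt_trans _ _ `|s|); last by rewrite (le_lt_trans sr)//; lra.
by case: (b == i); rewrite ?mulr1// mulr0 normr0.
Qed.

Section one_function.
Variable u : 'rV[R]_n -> R.
Hypotheses (Lu : lipschitz_within L K u) (cu : convex_on_segments K u).

Lemma derive_lipschitz_le x : interior K x -> derivable u x e -> `|'D_e u x| <= L.
Proof.
move=> /interior_core[delta d0 Ux] du.
have h1 := derive_le_slope cu du d0 Ux.1.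
have h2 := slope_le_derive cu du d0 Ux.2.
have := fwd_lip Lu e1 d0 Ux.1.
have Kx := core_sub (ltW d0) Ux.
have := Lu (core_end d0 Ux) Kx; rewrite (enorm_bwd e1) (gtr0_norm d0).
rewrite !ler_norml => /andP[? ?] /andP[? ?].
apply/andP; split; rewrite -(ler_pM2l d0); lra.
Qed.

(** Fatou's lemma, applied to the second difference quotients: their integrals
   tend to zero with the step. *)
Lemma negligible_not_derivable :
  mu.-negligible [set x | interior K x /\ ~ derivable u x e].
Proof.
pose d m : R := m.+1%:R^-1.
have dp m : 0 < d m by rewrite invr_gt0.
have mU m : measurable (core K e (d m)) by exact: measurable_core.
have msd m : measurable_fun (core K e (d m)) (second_diff u e (d m)).
  exact: (measurable_second_diff cptK L0 Lu (dp m)).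
pose S m : 'rV[R]_n -> \bar R :=
  (fun x => (m.+1%:R * second_diff u e (d m) x)%:E) \_ (core K e (d m)).
have S0 m x : (0 <= S m x)%E.
  apply: erestrict_ge0 => y Uy; rewrite lee_fin mulr_ge0//.
  by apply: (second_diff_ge0 cu) => //; exact: ltW.
have mS m : measurable_fun setT (S m).
  have msd' : measurable_fun (core K e (d m))
      (fun x : 'rV[R]_n => m.+1%:R * second_diff u e (d m) x).
    apply: measurable_funM; first exact: measurable_cst.
    exact: msd.
  exact: (measurable_restrictT _ (mU m)).1 ((measurable_EFinP _ _).2 msd').
have intS m : (\int[mu]_x S m x <= (2 * L * C * H * d m)%:E)%E.
  rewrite /S -integral_mkcond; under eq_integral do rewrite EFinM.
  rewrite ge0_integralZl_EFin//; last 2 first.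
  - move=> x Ux; rewrite lee_fin; apply: (second_diff_ge0 cu) => //; exact: ltW.
  - by apply/measurable_EFinP; exact: msd.
  apply: (@le_trans _ _ (m.+1%:R%:E * ((2 * L * d m)%:E * (C * d m * H)%:E))%E).
    rewrite lee_wpmul2l ?lee_fin//.
    apply: le_trans (integral_second_diff cptK L0 Lu e1 (dp m) cu) _.
    by rewrite lee_wpmul2l ?core_defect// lee_fin !mulr_ge0// ltW.
  rewrite -!EFinM lee_fin le_eqVlt; apply/orP; left; apply/eqP.
  by rewrite /d; field; rewrite nat1r pnatr_eq0.
have lim0 : limn_einf (fun m => \int[mu]_x S m x)%E = 0%E.
  have : (fun m => \int[mu]_x S m x)%E @ \oo --> 0%E.
    apply: (@squeeze_cvge _ _ _ _ (cst 0%E) _ (fun m => (2 * L * C * H * d m)%:E)).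
    - by apply: nearW => m; rewrite intS andbT integral_ge0.
    - exact: cvg_cst.
    - have : (fun m => (2 * L * C * H * d m)%:E) @ \oo --> (2 * L * C * H * 0)%:E.
        apply: cvg_EFin; first by apply: nearW.
        by apply: cvgMr; exact: cvg_harmonic.
      by rewrite mulr0.
  by move=> /cvg_limn_einf_sup[].
pose l x := limn_einf (fun m => S m x).
have lE x : l x = ereal_sup (range (einfs (S ^~ x))).
  by rewrite /l limn_einf_lim; apply/cvg_lim => //; exact: cvg_einfs_sup.
have einfs_le x M : (einfs (S ^~ x) M <= l x)%E.
  by rewrite lE; apply: ereal_sup_ubound; exists M.
have l0 x : (0 <= l x)%E.
  apply: le_trans (einfs_le x 0%N).
  by apply: le_ereal_inf_tmp => _ [m _ <-]; exact: S0.
have ml : measurable_fun setT l.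
  apply: measurableT_comp => //; apply: measurable_fun_limn_esup => m.
  exact: measurableT_comp.
have int0 : (\int[mu]_x `|l x| = 0)%E.
  under eq_integral do rewrite gee0_abs//.
  apply/eqP; rewrite eq_le integral_ge0// andbT -lim0.
  by apply: fatou.
have := (ae_eq_integral_abs mu measurableT ml).1 int0.
apply: negligibleS => x [Kx ndx] lx0; apply: ndx.
have {}lx0 := lx0 I.
have [delta d0 Ux] := interior_core Kx.
apply: (derivable_second_diff cu d0 Ux) => eps eps0.
have [M] := ltr_add_invr d0; rewrite add0r => Md.
apply: contrapT => nh.
(* Otherwise all the quotients of small step are at least [eps]. *)
have : (eps%:E <= l x)%E.
  apply: le_trans (einfs_le x M); apply: le_ereal_inf_tmp => _ [m /= Mm <-].
  have dm : d m <= delta.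
    apply: le_trans (ltW Md); rewrite /d lef_pV2 ?posrE// ler_nat; exact: Mm.
  rewrite /S patchE mem_set; last exact: coreS Ux.
  rewrite lee_fin leNgt; apply/negP => lt; apply: nh; exists (d m).
    by rewrite dp.
  by rewrite /d -ler_pdivrMl ?invr_gt0// invrK ltW.
by rewrite lx0 lee_fin leNgt eps0.
Qed.

End one_function.

Section two_functions.
Variables u v : 'rV[R]_n -> R.
Hypotheses (Lu : lipschitz_within L K u) (cu : convex_on_segments K u).
Hypotheses (Lv : lipschitz_within L K v) (cv : convex_on_segments K v).
Let w x := u x - v x.
Let A : \bar R := (\int[mu]_(x in K) (w x ^+ 2)%:E)%E.

(** The first term bounds the square of the difference quotient of [w]. The
   second bounds the square of the second differences over [delta], one factor
   being at most [4 * L]. *)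
Definition inner_bound (delta : R) (x : 'rV[R]_n) : R :=
  4 / delta ^+ 2 * (w (x + delta *: e) ^+ 2 + w x ^+ 2)
  + 8 * L / delta * (second_diff u e delta x + second_diff v e delta x).

(** A measurable bound on the squared partial derivative of [w]: away from the
   core only the Lipschitz bound on the two derivatives is available. *)
Definition derivative_bound (delta : R) (x : 'rV[R]_n) : \bar R :=
  (((EFin \o inner_bound delta) \_ (core K e delta)) x
   + ((cst (4 * L ^+ 2)%:E) \_ (K `\` core K e delta)) x)%E.

(** Where both functions are derivable, [u'(x)] is at most the slope of [u] on
   [x, x + delta] and [v'(x)] at least that of [v] on [x - delta, x], so that
   [u'(x) - v'(x)] is a difference quotient of [u - v] up to a second
   difference of [v]. *)
Lemma derivative_bound_le (delta : R) x : 0 < delta -> interior K x ->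
  derivable u x e -> derivable v x e ->
  ((('D_e u x - 'D_e v x) ^+ 2)%:E <= derivative_bound delta x)%E.
Proof.
move=> d0 Kx du dv; rewrite /derivative_bound !patchE.
have KK : K x by exact: interior_subset Kx.
have [Ux|nUx] := boolP (x \in core K e delta); last first.
  rewrite mem_set; last by split => // Ux; rewrite mem_set in nUx.
  rewrite add0e lee_fin.
  have := derive_lipschitz_le Lu cu Kx du.
  have := derive_lipschitz_le Lv cv Kx dv.
  rewrite !ler_norml => /andP[? ?] /andP[? ?].
  have -> : 4 * L ^+ 2 = (2 * L) ^+ 2 by rewrite exprMn; congr (_ * _); ring.
  rewrite -[X in X <= _]real_normK ?num_real// lerXn2r ?nnegrE ?mulr_ge0//.
  by rewrite ler_norml; apply/andP; split; lra.
rewrite memNset ?adde0; last by case=> _; rewrite inE in Ux.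
rewrite inE in Ux; have [Px Nx] := Ux.
rewrite lee_fin /inner_bound.
have u1 := derive_le_slope cu du d0 Px.
have u2 := slope_le_derive cu du d0 Nx.
have v1 := derive_le_slope cv dv d0 Px.
have v2 := slope_le_derive cv dv d0 Nx.
have su0 := second_diff_ge0 cu Ux (ltW d0).
have sv0 := second_diff_ge0 cv Ux (ltW d0).
have su2 := second_diff_le Lu e1 d0 Ux.
have sv2 := second_diff_le Lv e1 d0 Ux.
set D := 'D_e u x - 'D_e v x.
set a := w (x + delta *: e); set b := w x.
set s := second_diff u e delta x + second_diff v e delta x.
have Dab : `|delta * D - (a - b)| <= s.
  rewrite ler_norml /s /D /a /b /w /second_diff; apply/andP; split; lra.
have s0 : 0 <= s by rewrite /s; lra.
have s4 : s <= 4 * L * delta by rewrite /s; lra.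
have d2 : 0 < delta ^+ 2 by rewrite exprn_gt0.
rewrite -(ler_pM2l d2).
have -> : delta ^+ 2 * (4 / delta ^+ 2 * (a ^+ 2 + b ^+ 2) + 8 * L / delta * s) =
    4 * (a ^+ 2 + b ^+ 2) + 8 * L * delta * s.
  by field; rewrite gt_eqF.
rewrite -exprMn; set t := delta * D in Dab *.
have t2 : (t - (a - b)) ^+ 2 <= s ^+ 2.
  by rewrite -[(t - _) ^+ 2]real_normK ?num_real// lerXn2r ?nnegrE.
have ss : s ^+ 2 <= 4 * L * delta * s by rewrite expr2 ler_wpM2r.
(* [t ^ 2 <= 2 * (a - b) ^ 2 + 2 * (t - (a - b)) ^ 2], and
   [2 * (a - b) ^ 2 <= 4 * (a ^ 2 + b ^ 2)]. *)
have := sqr_ge0 (t - 2 * (a - b)); have := sqr_ge0 (a + b).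
rewrite !expr2 in t2 ss *; nra.
Qed.

Lemma measurable_w (c : 'rV[R]_n) (D : set 'rV[R]_n) : measurable D ->
  (forall x, D x -> K (x + c)) ->
  measurable_fun D (fun x => (w (x + c) ^+ 2)%:E).
Proof.
move=> mD DK.
have m : measurable_fun D (fun x : 'rV[R]_n => w (x + c) ^+ 2).
  apply: measurable_funX; apply: measurable_funB.
    exact: (measurable_shift cptK L0 Lu mD DK).
  exact: (measurable_shift cptK L0 Lv mD DK).
exact: (measurable_EFinP _ _).2 m.
Qed.

Lemma measurable_inner_bound (delta : R) : 0 < delta ->
  measurable_fun (core K e delta) (inner_bound delta).
Proof.
move=> d0; have mU := measurable_core cptK e delta.
have mw c : (forall x, core K e delta x -> K (x + c)) ->
    measurable_fun (core K e delta) (fun x : 'rV[R]_n => w (x + c) ^+ 2).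
  by move=> UK; exact: (measurable_EFinP _ _).1 (measurable_w mU UK).
have su := measurable_second_diff cptK L0 Lu (e := e) d0.
have sv := measurable_second_diff cptK L0 Lv (e := e) d0.
apply: measurable_funD.
  apply: measurable_funM; first exact: measurable_cst.
  apply: measurable_funD; first by apply: mw => x; exact: core_endr.
  have := mw 0; under eq_fun do rewrite addr0; apply => x Ux; rewrite addr0.
  exact: (core_sub (ltW d0) Ux).
apply: measurable_funM; first exact: measurable_cst.
exact: measurable_funD.
Qed.

Lemma inner_bound_ge0 (delta : R) x : 0 < delta -> core K e delta x ->
  0 <= inner_bound delta x.
Proof.
move=> d0 Ux; rewrite /inner_bound.
have := second_diff_ge0 cu Ux (ltW d0); have := second_diff_ge0 cv Ux (ltW d0).
move=> sv su; apply: addr_ge0; apply: mulr_ge0.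
- by rewrite divr_ge0// exprn_ge0// ltW.
- by rewrite addr_ge0// sqr_ge0.
- by rewrite divr_ge0 ?mulr_ge0// ltW.
- exact: addr_ge0.
Qed.

Lemma derivative_bound_ge0 (delta : R) x : 0 < delta ->
  (0 <= derivative_bound delta x)%E.
Proof.
move=> d0; apply: adde_ge0; apply: erestrict_ge0 => y Uy.
  by rewrite lee_fin inner_bound_ge0.
by rewrite lee_fin mulr_ge0// sqr_ge0.
Qed.

Lemma measurable_derivative_bound (delta : R) : 0 < delta ->
  measurable_fun setT (derivative_bound delta).
Proof.
move=> d0; have mU := measurable_core cptK e delta.
have mV : measurable (K `\` core K e delta).
  by apply: measurableD => //; exact: measurable_compact_rV.
apply: emeasurable_funD.
  have mi := (measurable_EFinP _ _).2 (measurable_inner_bound d0).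
  exact: (measurable_restrictT _ mU).1 mi.
apply: (measurable_restrictT _ mV).1; exact: measurable_cst.
Qed.

Lemma integral_derivative_bound (delta : R) : 0 < delta ->
  (\int[mu]_x derivative_bound delta x <=
   (8 / delta ^+ 2)%:E * A + (36 * L ^+ 2 * C * delta * H)%:E)%E.
Proof.
move=> d0; set U := core K e delta.
have mU : measurable U := measurable_core cptK e delta.
have mK := measurable_compact_rV cptK.
have mV : measurable (K `\` U) by exact: measurableD.
have UK : U `<=` K := core_sub (ltW d0).
have mi := (measurable_EFinP _ _).2 (measurable_inner_bound d0).
have w0 (x : 'rV[R]_n) : (0 <= (w x ^+ 2)%:E)%E by rewrite lee_fin sqr_ge0.
rewrite ge0_integralD//; last 4 first.
- by move=> x _; apply: erestrict_ge0 => y Uy; rewrite lee_fin inner_bound_ge0.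
- exact: (measurable_restrictT _ mU).1 mi.
- by move=> x _; apply: erestrict_ge0 => y Uy; rewrite lee_fin mulr_ge0// sqr_ge0.
- by apply: (measurable_restrictT _ mV).1; exact: measurable_cst.
rewrite -!integral_mkcond integral_cst//.
have mwK : measurable_fun K (fun x => (w x ^+ 2)%:E).
  have := @measurable_w 0 K mK; under eq_fun do rewrite addr0.
  by apply => x; rewrite addr0.
have mw1 : measurable_fun U (fun x => (w (x + delta *: e) ^+ 2)%:E).
  by apply: measurable_w => // x; exact: core_endr.
have mw0 : measurable_fun U (fun x => (w x ^+ 2)%:E) by exact: measurable_funS mwK.
have msu : measurable_fun U (fun x => (second_diff u e delta x)%:E).
  exact: (measurable_EFinP _ _).2 (measurable_second_diff cptK L0 Lu d0).
have msv : measurable_fun U (fun x => (second_diff v e delta x)%:E).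
  exact: (measurable_EFinP _ _).2 (measurable_second_diff cptK L0 Lv d0).
have su0 x : U x -> (0 <= (second_diff u e delta x)%:E)%E.
  by move=> Ux; rewrite lee_fin; apply: (second_diff_ge0 cu) => //; exact: ltW.
have sv0 x : U x -> (0 <= (second_diff v e delta x)%:E)%E.
  by move=> Ux; rewrite lee_fin; apply: (second_diff_ge0 cv) => //; exact: ltW.
have c1 : 0 <= 4 / delta ^+ 2 by rewrite divr_ge0// exprn_ge0// ltW.
have c2 : 0 <= 8 * L / delta by rewrite divr_ge0 ?mulr_ge0// ltW.
have -> : (\int[mu]_(x in U) (EFin \o inner_bound delta) x =
  (4 / delta ^+ 2)%:E * (\int[mu]_(x in U) (w (x + delta *: e) ^+ 2)%:E
     + \int[mu]_(x in U) (w x ^+ 2)%:E)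
  + (8 * L / delta)%:E * (\int[mu]_(x in U) (second_diff u e delta x)%:E
     + \int[mu]_(x in U) (second_diff v e delta x)%:E))%E.
  rewrite -!ge0_integralD// -!ge0_integralZl_EFin//; last 4 first.
  - by move=> x Ux; rewrite adde_ge0 ?su0 ?sv0.
  - exact: emeasurable_funD.
  - by move=> x Ux; rewrite adde_ge0.
  - exact: emeasurable_funD.
  rewrite -ge0_integralD//.
  - by move=> x Ux; rewrite mule_ge0// ?adde_ge0// lee_fin.
  - by apply: measurable_funeM; exact: emeasurable_funD.
  - by move=> x Ux; rewrite mule_ge0 ?adde_ge0 ?su0 ?sv0// lee_fin.
  - by apply: measurable_funeM; exact: emeasurable_funD.
have A1 : (\int[mu]_(x in U) (w x ^+ 2)%:E <= A)%E by exact: ge0_subset_integral.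
have A2 : (\int[mu]_(x in U) (w (x + delta *: e)%R ^+ 2)%:E <= A)%E.
  have tr := @ge0_integral_translation R n (delta *: e) K _ mK mwK (fun x _ => w0 x).
  rewrite /A tr.
  have mpre : measurable ((fun x : 'rV[R]_n => x + delta *: e) @^-1` K).
    by rewrite -[X in measurable X]setTI; exact: measurable_translation.
  apply: ge0_subset_integral => //; first exact: measurable_w.
  by move=> x; exact: core_endr.
have t0 : (0 <= (2 * L * delta)%:E)%E by rewrite lee_fin !mulr_ge0// ltW.
have defect := lee_wpmul2l t0 (core_defect d0).
have S1 := le_trans (integral_second_diff cptK L0 Lu e1 d0 cu) defect.
have S2 := le_trans (integral_second_diff cptK L0 Lv e1 d0 cv) defect.
have HE : (36 * L ^+ 2 * C * delta * H)%:E = ((8 * L / delta)%:E *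
    ((2 * L * delta)%:E * (C * delta * H)%:E + (2 * L * delta)%:E * (C * delta * H)%:E)
    + (4 * L ^+ 2)%:E * (C * delta * H)%:E)%E.
  by rewrite -!(EFinM, EFinD); congr EFin; field; rewrite gt_eqF.
have AE : ((8 / delta ^+ 2)%:E * A = (4 / delta ^+ 2)%:E * (A + A))%E.
  rewrite -mule2n -mule_natl muleA -EFinM; congr (_%:E * _)%E.
  by field; rewrite gt_eqF.
rewrite HE AE [X in (_ <= X)%E]addeA; apply: leeD; first apply: leeD.
- by rewrite lee_wpmul2l ?lee_fin// leeD.
- by rewrite lee_wpmul2l ?lee_fin// leeD.
- by rewrite lee_wpmul2l ?core_defect// lee_fin mulr_ge0// sqr_ge0.
Qed.

End two_functions.
End directional.

(** * The gradient estimate *)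

Section gradient.
Context {R : realType} {k : nat}.
Notation n := k.+1.
Notation mu := (@lebesgue_rV R n).
Variables (K : set 'rV[R]_n) (L : R) (u v : 'rV[R]_n -> R).
Hypotheses (cptK : compact K) (L0 : 0 <= L).
Hypothesis rectK : rectifiable k (boundary K).
Hypotheses (Lu : lipschitz_within L K u) (cu : convex_on_segments K u).
Hypotheses (Lv : lipschitz_within L K v) (cv : convex_on_segments K v).
Let w x := u x - v x.
Let A : \bar R := (\int[mu]_(x in K) (w x ^+ 2)%:E)%E.
Let X : \bar R :=
  (\int[mu]_(x in K) (enorm (gradient u x - gradient v x) ^+ 2)%:E)%E.
Let H : \bar R := hausdorff_measure k (boundary K).

Lemma interiorI x : K x -> ~ boundary K x -> interior K x.
Proof.
move=> Kx nb; apply: contrapT => nK; apply: nb; split => //.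
exact: subset_closure.
Qed.

Lemma enorm_gradientB x : enorm (gradient u x - gradient v x) ^+ 2 =
  \sum_(i < n) ('D_(delta_mx 0 i) u x - 'D_(delta_mx 0 i) v x) ^+ 2.
Proof.
rewrite /enorm sqr_sqrtr; last by apply: sumr_ge0 => i _; exact: sqr_ge0.
by apply: eq_bigr => i _; rewrite !mxE.
Qed.

Lemma gradient_bound (delta : R) : H \is a fin_num -> 0 < delta ->
  (X <= (n%:R * (8 / delta ^+ 2))%:E * A
     + (n%:R * (36 * L ^+ 2 * strip_const k * delta * fine H))%:E)%E.
Proof.
move=> Hfin d0.
pose N (i : 'I_n) :=
  [set x | interior K x /\ ~ derivable u x (delta_mx 0 i)] `|`
  [set x | interior K x /\ ~ derivable v x (delta_mx 0 i)].
pose Z := boundary K `|` \big[setU/set0]_(i < n) N i.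
have Zneg : mu.-negligible Z.
  apply: negligibleU; first exact: rectifiable_negligible.
  elim/big_ind : _ => [|B C ? ?|i _]; first exact: negligible_set0.
    exact: negligibleU.
  by apply: negligibleU; [exact: (negligible_not_derivable _ cptK L0 Hfin Lu cu)|
                          exact: (negligible_not_derivable _ cptK L0 Hfin Lv cv)].
pose g x := (\sum_(i < n) derivative_bound K L i u v delta x)%E.
have b0 i x := derivative_bound_ge0 i L0 cu cv x d0.
have mb i := measurable_derivative_bound i cptK L0 Lu Lv d0.
apply: (@le_trans _ _ (\int[mu]_x g x)%E).
  rewrite /X integral_mkcond; apply: (ge0_le_integral_negligible (Z := Z)) => //.
  - by move=> x; apply: erestrict_ge0 => y _; rewrite lee_fin sqr_ge0.
  - by move=> x; apply: sume_ge0 => i _; exact: b0.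
  - by apply: emeasurable_sum => i; exact: mb.
  move=> x nZ; rewrite patchE; case: ifPn => [|_]; last by apply: sume_ge0.
  rewrite inE => Kx; have Ix : interior K x by apply: interiorI => // bx; apply: nZ; left.
  rewrite enorm_gradientB -sumEFin; apply: lee_sum => i _.
  have nN : ~ N i x.
    move=> Nx; apply: nZ; right; rewrite -bigcup_seq; exists i => //.
    by rewrite /= mem_index_enum.
  apply: (derivative_bound_le L0 Lu cu Lv cv d0 Ix).
    by apply: contrapT => nd; apply: nN; left.
  by apply: contrapT => nd; apply: nN; right.
rewrite ge0_integral_sum//.
apply: (@le_trans _ _ (\sum_(i < n) ((8 / delta ^+ 2)%:E * A +
   (36 * L ^+ 2 * strip_const k * delta * fine H)%:E))%E).
  by apply: lee_sum => i _; exact: integral_derivative_bound.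
have c0 : 0 <= 8 / delta ^+ 2 by rewrite divr_ge0// exprn_ge0// ltW.
have sumA (c : R) m : 0 <= c ->
    (\sum_(i < m) c%:E * A = (m%:R * c)%:E * A)%E.
  move=> cge0; elim: m => [|m IH]; first by rewrite big_ord0 mul0r mul0e.
  rewrite big_ord_recr /= IH -natr1 mulrDl mul1r EFinD ge0_muleDl ?lee_fin//.
  by rewrite mulr_ge0.
rewrite big_split /= [X in (X + _)%E](sumA _ _ c0) sumEFin sumr_const card_ord.
by rewrite -[X in (_ + X%:E)%E]mulr_natl.
Qed.

Lemma gradient_eq0 : (forall x, interior K x -> gradient u x = gradient v x) ->
  X = 0%E.
Proof.
move=> uv; apply/eqP; rewrite eq_le; apply/andP; split; last first.
  by apply: integral_ge0 => x _; rewrite lee_fin sqr_ge0.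
apply: (@le_trans _ _ (\int[mu]_x (cst 0%E) x)%E); last by rewrite integral0.
rewrite /X integral_mkcond.
apply: (ge0_le_integral_negligible (Z := boundary K)) => //.
- by move=> x; apply: erestrict_ge0 => y _; rewrite lee_fin sqr_ge0.
- exact: rectifiable_negligible.
move=> x nb; rewrite patchE; case: ifPn => //; rewrite inE => Kx.
rewrite uv ?subrr; last exact: interiorI.
by rewrite /enorm big1 ?sqrtr0 ?expr0n// => i _; rewrite mxE expr0n.
Qed.

Lemma gradient_lipschitz0 (f : 'rV[R]_n -> R) x :
  lipschitz_within 0 K f -> interior K x -> gradient f x = 0.
Proof.
move=> f0 Ix; have Kx := nbhs_singleton Ix; apply/rowP => i; rewrite !mxE.
have : \forall y \near x, f y = cst (f x) y.
  apply: filterS Ix => y Ky; apply/eqP; rewrite -subr_eq0 -normr_le0.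
  by rewrite (le_trans (f0 _ _ Ky Kx)) ?mul0r.
by move=> /near_eq_derive ->; rewrite derive_cst.
Qed.

(** A nonzero value of [w] at an interior point persists on a ball by Lipschitz
   continuity, which contributes to the norm. Hence [u] and [v] agree near every
   interior point, and so do their gradients there, even where the partial
   derivatives do not exist. *)
Lemma gradient_norm0 : A = 0%E ->
  forall x, interior K x -> gradient u x = gradient v x.
Proof.
move=> A0.
have mK := measurable_compact_rV cptK.
have mw : measurable_fun K (fun x => (w x ^+ 2)%:E).
  have := @measurable_w _ _ _ _ cptK L0 _ _ Lu Lv 0 K mK.
  by under eq_fun do rewrite addr0; apply => x; rewrite addr0.
have [N [mN N0 KN]] : ae_eq mu K (fun x => (w x ^+ 2)%:E) (cst 0%E).
  apply/ae_eq_integral_abs => //; rewrite -[RHS]A0 /A.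
  by apply: eq_integral => x _; rewrite gee0_abs// lee_fin sqr_ge0.
have w0 x : interior K x -> w x = 0.
  move=> Ix; have Kx := nbhs_singleton Ix; apply: contrapT => /eqP wx.
  have [r /= r0 rK] : exists2 r : R, 0 < r & ball x r `<=` K.
    by move/nbhs_ballP : Ix => [r]; exists r.
  (* [w] does not vanish on the box of half-side less than [c] around [x]. *)
  pose c := `|w x| / (2 * L * n%:R + 1).
  have wx0 : 0 < `|w x| by rewrite normr_gt0.
  have c'0 : 0 < 2 * L * n%:R + 1 by rewrite ltr_wpDl// !mulr_ge0.
  have c0 : 0 < c by rewrite divr_gt0.
  pose s := Num.min (r / 2) (c / 2).
  have s0 : 0 < s by rewrite lt_min !divr_gt0.
  have sc : s < c by rewrite gt_min; apply/orP; right; lra.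
  have sr : s < r by rewrite gt_min; apply/orP; left; lra.
  have E := @lebesgue_rV_cbox R n x (fun=> s) (fun=> ltW s0).
  pose B := [set y : 'rV[R]_n | forall i, `[x 0 i - s, x 0 i + s]%classic (y 0 i)].
  suff : (mu B <= 0)%E.
    rewrite /B E lee_fin leNgt => /negP; apply; apply: prodr_gt0 => i _.
    by rewrite mulr_gt0.
  rewrite -N0; apply: le_measure; rewrite ?inE//.
    exact: (@measurable_rV_box _ _ (fun i => `[x 0 i - s, x 0 i + s]%classic)).
  move=> y ys; apply: KN => /=.
  have ys' (i : 'I_n) : `|y 0 i - x 0 i| <= s.
    by have := ys i; rewrite /= in_itv/= ler_distl.
  have Ky : K y.
    apply: rK; split => // a b; rewrite ord1 /ball/= distrC.
    exact: le_lt_trans (ys' b) sr.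
  move=> /(_ Ky)/eqP; rewrite eqe sqrf_eq0 => /eqP wy0.
  have : `|w x| <= 2 * L * enorm (y - x).
    have := Lu Ky Kx; have := Lv Ky Kx.
    have -> : w x = (u x - u y) - (v x - v y) by move: wy0; rewrite /w; lra.
    have := ler_normB (u x - u y) (v x - v y).
    by rewrite (distrC (u x)) (distrC (v x)); lra.
  apply/negP; rewrite -ltNge.
  have en : enorm (y - x) <= n%:R * s.
    apply: le_trans (enorm_le_sum _) _; rewrite mulr_natl -[X in _ *+ X]card_ord -sumr_const.
    by apply: ler_sum => i _; rewrite !mxE.
  apply: (@le_lt_trans _ _ (2 * L * (n%:R * s))); first by rewrite ler_wpM2l// mulr_ge0.
  move: sc; rewrite /c ltr_pdivlMr//; lra.
move=> x Ix; apply/rowP => i; rewrite !mxE; apply: near_eq_derive.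
have : nbhs x (interior K) by exact: nbhs_interior.
apply: filterS => y Iy; apply/eqP; rewrite -subr_eq0; apply/eqP; exact: w0.
Qed.

Lemma norm_fin : A \is a fin_num.
Proof.
have A0 : (0 <= A)%E by apply: integral_ge0 => x _; rewrite lee_fin sqr_ge0.
rewrite ge0_fin_numE//.
have mK := measurable_compact_rV cptK.
have [K0|/set0P[p Kp]] := eqVneq K set0.
  by rewrite /A K0 integral_set0.
have [M M0 KM] := compact_rV_bounded cptK.
have mw : measurable_fun K (fun x => (w x ^+ 2)%:E).
  have := @measurable_w _ _ _ _ cptK L0 _ _ Lu Lv 0 K mK.
  by under eq_fun do rewrite addr0; apply => x; rewrite addr0.
pose B := `|w p| + 2 * L * (n%:R * (2 * M)).
have wB x : K x -> `|w x| <= B.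
  move=> Kx; have en : enorm (x - p) <= n%:R * (2 * M).
    apply: le_trans (enorm_le_sum _) _; rewrite mulr_natl -[X in _ *+ X]card_ord -sumr_const.
    apply: ler_sum => i _; rewrite !mxE; apply: le_trans (ler_normB _ _) _.
    by have := KM _ Kx i; have := KM _ Kp i; lra.
  have LE := ler_wpM2l L0 en.
  have := Lu Kx Kp; have := Lv Kx Kp.
  have := ler_normB (u x - u p) (v x - v p).
  have := ler_normD (w p) ((u x - u p) - (v x - v p)).
  have -> : w p + ((u x - u p) - (v x - v p)) = w x by rewrite /w; ring.
  rewrite /B; lra.
apply: (@le_lt_trans _ _ (\int[mu]_(x in K) (cst (B ^+ 2)%:E) x)%E).
  apply: ge0_le_integral => //.
  - by move=> x _; rewrite lee_fin sqr_ge0.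
  - move=> x Kx; rewrite lee_fin -[w x ^+ 2]real_normK ?num_real//.
    by rewrite lerXn2r ?nnegrE// ?(le_trans _ (wB _ Kx)) ?wB.
rewrite integral_cst// lte_mul_pinfty ?lee_fin ?sqr_ge0//.
exact: compact_rV_finite.
Qed.

End gradient.

(** The optimal step is [delta = (a / b) ^ (1 / 3)]; the degenerate cases are
   limits [delta -> 0] or [delta -> +oo]. *)
Lemma optimize_step (R : realType) (c a b : R) (X : \bar R) :
  0 <= c -> 0 <= a -> 0 <= b ->
  (forall delta : R, 0 < delta ->
    (X <= (c * (a / delta ^+ 2 + b * delta))%:E)%E) ->
  (X <= (2 * c * (b `^ (2 / 3) * a `^ (1 / 3)))%:E)%E.
Proof.
move=> c0 a0 b0 HX.
have pos : 0 <= 2 * c * (b `^ (2 / 3) * a `^ (1 / 3)).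
  by rewrite !mulr_ge0// powR_ge0.
have [az|an] := eqVneq a 0.
  apply: (@le_trans _ _ 0%E); last by rewrite lee_fin.
  apply/lee_addgt0Pr => eps eps0; rewrite add0e.
  have p : 0 < c * b + 1 by rewrite ltr_wpDl// mulr_ge0.
  apply: le_trans (HX (eps / (c * b + 1)) _) _; first by rewrite divr_gt0.
  rewrite lee_fin az mul0r add0r !mulrA ler_pdivrMr// mulrDr mulr1.
  by rewrite mulrC lerDl ltW.
have [bz|bn] := eqVneq b 0.
  apply: (@le_trans _ _ 0%E); last by rewrite lee_fin.
  apply/lee_addgt0Pr => eps eps0; rewrite add0e.
  (* [d >= 1] and [eps * d >= c * a], so that [c * a / d ^ 2 <= eps]. *)
  pose d := 1 + c * a / eps.
  have d1 : 1 <= d by rewrite lerDl divr_ge0 ?mulr_ge0// ltW.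
  have d0 : 0 < d by lra.
  apply: le_trans (HX d d0) _.
  rewrite lee_fin bz mul0r addr0 mulrA ler_pdivrMr ?exprn_gt0//.
  apply: (@le_trans _ _ (eps * d)).
    by rewrite /d mulrDr mulr1 mulrCA divff ?gt_eqF// mulr1 lerDr ltW.
  by rewrite ler_wpM2l ?(ltW eps0)// expr2 ler_peMl// ltW.
have ap : 0 < a by rewrite lt_neqAle eq_sym an.
have bp : 0 < b by rewrite lt_neqAle eq_sym bn.
set p := a `^ (1 / 3); pose q := b `^ (1 / 3).
have p0 : 0 < p by exact: powR_gt0.
have q0 : 0 < q by exact: powR_gt0.
have p3 : a = p ^+ 3.
  by rewrite /p -powR_mulrn ?powR_ge0// -powRrM div1r mulVf// powRr1// ltW.
have q3 : b = q ^+ 3.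
  by rewrite /q -powR_mulrn ?powR_ge0// -powRrM div1r mulVf// powRr1// ltW.
have q2 : b `^ (2 / 3) = q ^+ 2.
  by rewrite /q -powR_mulrn ?powR_ge0// -powRrM; congr (_ `^ _); lra.
apply: le_trans; first by apply: (HX (p / q)); rewrite divr_gt0.
rewrite lee_fin q2 le_eqVlt; apply/orP; left; apply/eqP.
by rewrite p3 q3; field; rewrite !gt_eqF.
Qed.

Section L2norm.
Context {R : realType} {n : nat}.
Notation mu := (@lebesgue_rV R n).
Implicit Types (K : set 'rV[R]_n) (f : 'rV[R]_n -> R).

Lemma L2norm_powR2 K f :
  (L2norm K f `^ 2 = \int[mu]_(x in K) (f x ^+ 2)%:E)%E.
Proof.
rewrite /L2norm powR_Lnorm// [RHS]integral_mkcond; apply: eq_integral => x _.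
rewrite /= ?poweR_EFin (@powR_mulrn _ _ 2)// real_normK ?num_real//.
by rewrite !patchE; case: ifPn => //; rewrite expr0n.
Qed.

Lemma L2norm_sqr K f :
  (L2norm K f ^+ 2 = \int[mu]_(x in K) (f x ^+ 2)%:E)%E.
Proof.
rewrite -L2norm_powR2; have := Lnorm_ge0 mu 2%:E (EFin \o (f \_ K)).
rewrite -/(L2norm K f); case: (L2norm K f) => [r|_|//].
  by rewrite lee_fin => r0; rewrite -EFin_expe poweR_EFin (@powR_mulrn _ _ 2).
by rewrite poweRyr// expe2 mulyy.
Qed.

Lemma L2norm_powR23 K f :
  (L2norm K f `^ (2 / 3) = (\int[mu]_(x in K) (f x ^+ 2)%:E) `^ (1 / 3))%E.
Proof. by rewrite -L2norm_powR2 -poweRrM; congr (_ `^ _)%E; lra. Qed.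

End L2norm.

Theorem proposition4p1 (R : realType) (d : nat) (d_gt0 : (0 < d)%N) :
  exists C : R, forall (K : set 'rV[R]_d) (L : R) (u v : 'rV[R]_d -> R),
    compact K -> rectifiable d.-1 (boundary K) ->
    0 <= L ->
    lipschitz_within L K u -> lipschitz_within L K v ->
    convex_on_segments K u -> convex_on_segments K v ->
    (L2norm K (fun x => enorm (gradient u x - gradient v x)%R) ^+ 2 <=
     C%:E * hausdorff_measure d.-1 (boundary K) `^ (2 / 3)
          * (L `^ (4 / 3))%:E
          * L2norm K (fun x => u x - v x)%R `^ (2 / 3))%E.
Proof.
case: d d_gt0 => [//|k _]; rewrite succnK.
pose c : R := k.+1%:R * (8 + 36 * strip_const k).
have c0 : 0 < c.
  by rewrite mulr_gt0 ?ltr0n// addr_gt0// mulr_gt0// strip_const_gt0.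
exists (2 * c) => K L u v cptK rectK L0 Lu Lv cu cv.
rewrite L2norm_sqr L2norm_powR23.
set A := (\int[_]_(x in K) ((u x - v x) ^+ 2)%:E)%E.
have Afin : A \is a fin_num := norm_fin cptK L0 Lu Lv.
have A0 : (0 <= A)%E by apply: integral_ge0 => x _; rewrite lee_fin sqr_ge0.
have H0 := hausdorff_measure_ge0 k (boundary K).
have rhs0 : (0 <= (2 * c)%:E * hausdorff_measure k (boundary K) `^ (2 / 3)
    * (L `^ (4 / 3))%:E * A `^ (1 / 3))%E.
  by rewrite !mule_ge0 ?poweR_ge0// lee_fin ?powR_ge0// mulr_ge0// ltW.
have [Hfin|Hinf] := boolP (hausdorff_measure k (boundary K) \is a fin_num).
  set H := hausdorff_measure k (boundary K) in H0 Hfin *.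
  have h0 : 0 <= fine H by exact: fine_ge0.
  have a0 : 0 <= fine A by exact: fine_ge0.
  rewrite -(fineK Hfin) -(fineK Afin) !poweR_EFin -!EFinM.
  have -> : 2 * c * fine H `^ (2 / 3) * L `^ (4 / 3) * fine A `^ (1 / 3) =
      2 * c * ((L ^+ 2 * fine H) `^ (2 / 3) * fine A `^ (1 / 3)).
    rewrite powRM ?sqr_ge0// -(@powR_mulrn _ L 2)// -powRrM.
    by rewrite (_ : 2%:R * (2 / 3) = 4 / 3 :> R); [ring|lra].
  apply: optimize_step; rewrite ?(ltW c0) ?mulr_ge0 ?sqr_ge0// => delta d0.
  have := gradient_bound cptK L0 rectK Lu cu Lv cv Hfin d0.
  move=> /le_trans; apply; rewrite -/A -/H -[X in (_ * X)%E](fineK Afin).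
  rewrite -EFinM -EFinD lee_fin.
  have S0 : (0 : R) < strip_const k := strip_const_gt0 k.
  have ad : 0 <= fine A / delta ^+ 2 by rewrite divr_ge0// exprn_ge0// ltW.
  have bd : 0 <= L ^+ 2 * fine H * delta by rewrite !mulr_ge0 ?sqr_ge0// ltW.
  have -> : k.+1%:R * (8 / delta ^+ 2) * fine A = k.+1%:R * (8 * (fine A / delta ^+ 2)).
    by rewrite -!mulrA; congr (_ * (_ * _)); rewrite mulrC.
  have -> : k.+1%:R * (36 * L ^+ 2 * strip_const k * delta * fine H) =
      k.+1%:R * (36 * strip_const k * (L ^+ 2 * fine H * delta)) by ring.
  rewrite /c -mulrDr -[X in _ <= X]mulrA ler_wpM2l//.
  set s := 36 * strip_const k.
  have s0 : 0 <= s by rewrite mulr_ge0// ltW.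
  by have := mulr_ge0 s0 ad; lra.
have Hy : hausdorff_measure k (boundary K) = +oo%E.
  by apply/eqP; rewrite -leye_eq leNgt -ge0_fin_numE.
have [uv|uv] := pselect (forall x, interior K x -> gradient u x = gradient v x).
  by rewrite (gradient_eq0 rectK uv).
have An : (0 < A)%E.
  rewrite lt_neqAle A0 andbT eq_sym; apply/eqP => /(gradient_norm0 cptK L0 Lu Lv).
  exact: uv.
have Ln : 0 < L.
  rewrite lt_neqAle L0 andbT eq_sym; apply/eqP => Lz; apply: uv => x Ix.
  by rewrite Lz in Lu Lv; rewrite !(gradient_lipschitz0 _ Ix).
rewrite Hy poweRyr; last by rewrite gt_eqF// divr_gt0.
have cc : (0 < (2 * c)%:E)%E by rewrite lte_fin; apply: mulr_gt0.
rewrite (gt0_muley cc) gt0_mulye ?lte_fin ?powR_gt0//.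
by rewrite gt0_mulye ?leey// poweR_gt0.
Qed.
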